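(* Let $\Gamma$ satisfy the upper and lower assumptions stated in the context, and let $X(\Gamma)\subseteq\ell_\infty(\Gamma)$ be the associated space. The dual of $X(\Gamma)$ is $\ell_1(\Gamma)$; that is, the natural map $\ell_1(\Gamma)\to X(\Gamma)^*$, sending $g^*\in\ell_1(\Gamma)$ to the functional $x\mapsto\sum_{\gamma\in\Gamma}g^*(\gamma)x(\gamma)$, is a linear isomorphism (not necessarily isometric) of $\ell_1(\Gamma)$ onto $X(\Gamma)^*$.
   Context: All spaces are real; $\mathbb N=\{1,2,\dots\}$. Sequences: $(m_j)_{j\in\mathbb N}$, $(n_j)_{j\in\mathbb N}$ are sequences of natural numbers with $m_1\ge 4$, $m_{j+1}\ge m_j^2$, $n_{j+1}\ge m_{j+1}^2(4n_j)^{2^{j+1}}$. The set $\Gamma$: finite sets $\Delta_1,\Delta_2,\dots$ are given recursively, $\Delta_1=\{1\}$; $\Gamma_0=\emptyset$, $\Gamma_n=\bigcup_{p\le n}\Delta_p$, $\Gamma=\bigcup_p\Delta_p$; $\mathrm{rank}\,\gamma=n$ means $\gamma\in\Delta_n$. For $A\subseteq\Gamma$, $\ell_1(A)$ is regarded as a subspace of $\ell_1(\Gamma)$, and $e^*_\gamma$ is the unit vector of $\ell_1(\Gamma)$ at $\gamma$, acting by $x\mapsto x(\gamma)$. Every $\gamma\in\Delta_{n+1}$ ($n\ge1$) is a tuple, either of Type 1, $\gamma=(n+1,m_j^{-1},b^* )$, with $\mathrm{weight}\,\gamma=m_j$, $\mathrm{age}\,\gamma=1$, or of Type 2, $\gamma=(n+1,\xi,m_j^{-1},b^*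 )$ with $\xi\in\Gamma_n$, with $\mathrm{weight}\,\gamma=m_j$, $\mathrm{age}\,\gamma=1+\mathrm{age}\,\xi$; the element of $\Delta_1$ has no weight. Fix an increasing sequence $(N_n)$ of natural numbers and for $0\le p<n$ let $B_{n,p}$ be the set of all $b^*=\sum_{\eta\in\Gamma_n\setminus\Gamma_p}a_\eta e^*_\eta$ with $\sum|a_\eta|\le1$ and each $a_\eta$ rational with denominator dividing $N_n!$; the $N_n$ are chosen so that $B_{n,p}$ is a $2^{-n}$-net in the unit ball of $\ell_1(\Gamma_n\setminus\Gamma_p)$. Upper assumption: for all $n\ge1$, every element of $\Delta_{n+1}$ is either $(n+1,m_j^{-1},b^* )$ with $1\le j\le n+1$, $b^*\in B_{n,0}$, or $(n+1,\xi,m_j^{-1},b^* )$ with $0<p<n$, $1\le j\le p$, $\xi\in\Delta_p$, $\mathrm{weight}\,\xi=m_j$, $\mathrm{age}\,\xi<n_j$, $b^*\in B_{n,p}$. Lower assumption: for all $n\ge1$, $\Delta_{n+1}$ contains all $(n+1,m_{2j}^{-1},b^* )$ with $1\le j\le\lfloor(n+1)/2\rfloor$, $b^*\in B_{n,0}$, and all $(n+1,\xi,m_{2j}^{-1},b^* )$ with $1\le p<n$, $1\le j\le\lfloor p/2\rfloor$, $\xi\in\Delta_p$, $\mathrm{weight}\,\xi=m_{2j}$, $\mathrm{age}\,\xi<n_{2j}$, $b^*\in B_{n,p}$. The space: there are unique vectors $d^*_\gamma=e^*_\gamma-c^*_\gamma$ in $\ell_1(\Gamma)$ and bounded projections $P^*_{(0,q]}$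 on $\ell_1(\Gamma)$ ($q\ge0$, $P^*_{(0,0]}=0$) such that $P^*_{(0,q]}d^*_\gamma=d^*_\gamma$ if $\gamma\in\Gamma_q$ and $=0$ otherwise, and $c^*_\gamma=0$ for $\gamma\in\Delta_1$, $c^*_\gamma=m_j^{-1}b^*$ for $\gamma=(n+1,m_j^{-1},b^* )$, $c^*_\gamma=e^*_\xi+m_j^{-1}(I-P^*_{(0,\mathrm{rank}\,\xi]})b^*$ for $\gamma=(n+1,\xi,m_j^{-1},b^* )$. The family $(d^*_\gamma)$ is a basis of $\ell_1(\Gamma)$ (ordered by listing $\Delta_1,\Delta_2,\dots$ successively). Let $d_\gamma\in\ell_\infty(\Gamma)$ be the biorthogonal vectors. $X(\Gamma)$ is the closed linear span of $\{d_\gamma:\gamma\in\Gamma\}$ in $\ell_\infty(\Gamma)$ with the supremum norm. *)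

(* Defs.v *)
From HB Require Import structures.
From mathcomp Require Import all_boot all_order all_algebra.
From mathcomp Require Import all_classical all_reals all_analysis.

Set Implicit Arguments.
Unset Strict Implicit.
Unset Printing Implicit Defensive.

Import Order.TTheory GRing.Theory Num.Theory.
Import numFieldNormedType.Exports.

Local Open Scope classical_set_scope.
Local Open Scope ring_scope.

Section l1.
Variables (R : realType) (T : choiceType).

Definition is_l1 : {pred T -> R^o} :=
  fun f => `[< summable [set: T] (fun t => (f t)%:E) >].

Record l1 := L1 { l1_fun :> T -> R^o ; _ : l1_fun \in is_l1 }.

HB.instance Definition _ := [isSub for l1_fun].
HB.instance Definition _ := [Choice of l1 by <:].

Definition l1_sum (f : T -> R^o) : \bar R :=
  (\esum_(t in [set: T]) `|(f t)%:E|)%E.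

Let l1_sumZ a f : l1_sum (a *: f) = (`|a|%:E * l1_sum f)%E.
Proof.
rewrite /l1_sum; have [->|a0] := eqVneq a 0.
  rewrite normr0 mul0e esum1// => t _.
  by rewrite scale0r [X in `|X|%E](_ : _ = 0%E)// abse0.
have a_gt0 : 0 < `|a| by rewrite normr_gt0.
rewrite /esum -ereal_sup_pZl//; congr ereal_sup.
rewrite image_comp; apply: eq_imagel => A [finA _] /=.
rewrite ge0_mule_fsumr//; apply: eq_fsbigr => t _.
by rewrite -EFinM -normrM.
Qed.

Lemma l1_closed : subsemimod_closed is_l1.
Proof.
split; first split.
- by apply/asboolP; rewrite /summable esum1// => t _; rewrite abse0.
- move=> f g /asboolP fl /asboolP gl; apply/asboolP.
  exact: (summableD fl gl).
- move=> a f /asboolP fl; apply/asboolP; rewrite /summable.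
  have -> : (\esum_(x in [set: T]) `|((a *: f) x)%:E| = `|a|%:E * l1_sum f)%E.
    exact: l1_sumZ.
  by rewrite lte_mul_pinfty.
Qed.

HB.instance Definition _ := GRing.isSubmodClosed.Build R (T -> R^o) is_l1 l1_closed.
HB.instance Definition _ := [SubChoice_isSubLmodule of l1 by <:].

Definition l1_norm (f : l1) : R := fine (l1_sum f).

Lemma l1_fin (f : l1) : l1_sum f \is a fin_num.
Proof. by case: f => f fl; rewrite /l1_sum -summableE; exact/asboolP. Qed.

Lemma l1_normD (f g : l1) : l1_norm (f + g) <= l1_norm f + l1_norm g.
Proof.
rewrite /l1_norm -fineD ?l1_fin// fine_le ?fin_numD ?l1_fin//.
by rewrite -esumD//; apply: le_esum => t _; exact: (lee_abs_add (f t)%:E (g t)%:E).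
Qed.

Lemma l1_normZ a (f : l1) : l1_norm (a *: f) = `|a| * l1_norm f.
Proof.
rewrite /l1_norm -[X in fine X]/(l1_sum (a *: (f : T -> R^o))) l1_sumZ.
by rewrite fineM ?l1_fin.
Qed.

Lemma l1_norm_eq0 (f : l1) : l1_norm f = 0 -> f = 0.
Proof.
move=> f0; apply/val_inj/funext => t /=.
have : (`|(f t)%:E| <= l1_sum f)%E.
  rewrite /l1_sum (esumID [set t])// setTI esum_set1//.
  by rewrite leeDl// esum_ge0.
rewrite -(fineK (l1_fin f)) -[fine _]/(l1_norm f) f0 lee_fin normr_le0.
by move/eqP.
Qed.

HB.instance Definition _ :=
  Lmodule_isNormed.Build R l1 l1_normD l1_normZ l1_norm_eq0.

Lemma l1_normE (f : l1) : `|f| = l1_norm f. Proof. by []. Qed.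

Definition l1_unit_fun (g : T) : T -> R^o := fun t => (t == g)%:R.

Lemma l1_unit_subproof g : l1_unit_fun g \in is_l1.
Proof.
apply/asboolP; rewrite /summable (esumID [set g])// setTI [X in (_ + X)%E]esum1.
  by rewrite esum_set1// adde0 ltry.
by move=> t [_ /eqP]; rewrite /l1_unit_fun => /negbTE ->; rewrite abse0.
Qed.

Definition l1_unit g : l1 := L1 (l1_unit_subproof g).

End l1.

Section linf.
Variables (R : realType) (T : choiceType).

Definition is_linf : {pred T -> R^o} := fun f => `[< bounded_fun f >].

Record linf := Linf { linf_fun :> T -> R^o ; _ : linf_fun \in is_linf }.

HB.instance Definition _ := [isSub for linf_fun].
HB.instance Definition _ := [Choice of linf by <:].

Let is_linfP (f : T -> R^o) :
  (f \in is_linf) <-> exists M : R, forall t, `|f t| <= M.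
Proof.
split=> [/asboolP[M [_ fM]]|[M fM]].
  by exists (M + 1) => t; apply: fM => //; rewrite ltrDl.
apply/asboolP; exists M; split; first exact: num_real.
by move=> x /ltW Mx t _; exact: le_trans (fM t) Mx.
Qed.

Lemma linf_closed : subsemimod_closed is_linf.
Proof.
split; [split|]; last 1 first.
- move=> a f /is_linfP[M fM]; apply/is_linfP; exists (`|a| * M) => t.
  by rewrite normrM ler_wpM2l.
- by apply/is_linfP; exists 0 => t; rewrite normr0.
- move=> f g /is_linfP[M fM] /is_linfP[N gN]; apply/is_linfP.
  by exists (M + N) => t; rewrite (le_trans (ler_normD _ _))// lerD.
Qed.

HB.instance Definition _ :=
  GRing.isSubmodClosed.Build R (T -> R^o) is_linf linf_closed.
HB.instance Definition _ := [SubChoice_isSubLmodule of linf by <:].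

Definition linf_norm (f : linf) : R := sup (range (fun t => `|f t|)).

Lemma linf_norm_ub (f : linf) t : `|f t| <= linf_norm f.
Proof.
apply: ub_le_sup; last by exists t.
case: f => f /= /is_linfP[M fM]; exists M => _ [u _ <-]; exact: fM.
Qed.

Lemma linf_norm_le (f : linf) (M : R) : 0 <= M ->
  (forall t, `|f t| <= M) -> linf_norm f <= M.
Proof.
move=> M0 fM; rewrite /linf_norm.
have [->|ne] := eqVneq (range (fun t => `|f t|)) set0; first by rewrite sup0.
by apply: ge_sup; [exact/set0P|move=> _ [t _ <-]; exact: fM].
Qed.

Lemma linf_norm_ge0 (f : linf) : 0 <= linf_norm f.
Proof.
rewrite /linf_norm.
have [->|/set0P[_ [t _ _]]] := eqVneq (range (fun t => `|f t|)) set0.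
  by rewrite sup0.
exact: le_trans (linf_norm_ub f t).
Qed.

Lemma linf_normD (f g : linf) : linf_norm (f + g) <= linf_norm f + linf_norm g.
Proof.
apply: linf_norm_le => [|t]; first by rewrite addr_ge0// linf_norm_ge0.
by rewrite (le_trans (ler_normD _ _))// lerD// linf_norm_ub.
Qed.

Let linf_normZ_le a (f : linf) : linf_norm (a *: f) <= `|a| * linf_norm f.
Proof.
apply: linf_norm_le => [|t]; first by rewrite mulr_ge0// linf_norm_ge0.
by rewrite normrM ler_wpM2l// linf_norm_ub.
Qed.

Lemma linf_normZ a (f : linf) : linf_norm (a *: f) = `|a| * linf_norm f.
Proof.
apply/eqP; rewrite eq_le linf_normZ_le/=.
have [->|a0] := eqVneq a 0; first by rewrite normr0 mul0r linf_norm_ge0.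
rewrite -ler_pdivlMl ?normr_gt0// -normfV.
by rewrite -{1}[f](scalerK a0) linf_normZ_le.
Qed.

Lemma linf_norm_eq0 (f : linf) : linf_norm f = 0 -> f = 0.
Proof.
move=> f0; apply/val_inj/funext => t /=; apply/eqP.
by rewrite -normr_le0 -f0 linf_norm_ub.
Qed.

HB.instance Definition _ :=
  Lmodule_isNormed.Build R linf linf_normD linf_normZ linf_norm_eq0.

Lemma linf_normE (f : linf) : `|f| = linf_norm f. Proof. by []. Qed.

End linf.

Section closed_span.
Variables (R : realType) (V : normedModType R) (I : Type) (d : I -> V).

Definition lin_span : set V :=
  [set x | exists s : seq (R * I), x = \sum_(p <- s) p.1 *: d p.2].

Definition is_closed_span : {pred V} := fun x => `[< closure lin_span x >].

Record closed_span := ClosedSpan {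
  closed_span_val : V ; _ : closed_span_val \in is_closed_span }.

HB.instance Definition _ := [isSub for closed_span_val].
HB.instance Definition _ := [Choice of closed_span by <:].

Let closureP x : closure lin_span x <->
  forall e : R, 0 < e -> exists2 y, lin_span y & `|x - y| < e.
Proof.
split=> [cx e e0|cx B /nbhs_normP[e e0 eB]].
  have [|y [ly xy]] := cx (ball_ Num.norm x e).
    by apply/nbhs_normP; exists e.
  by exists y.
by have [y ly xy] := cx e e0; exists y; split=> //; exact: eB.
Qed.

Lemma closed_span_closed : subsemimod_closed is_closed_span.
Proof.
split; first split.
- by apply/asboolP/subset_closure; exists [::]; rewrite big_nil.
- move=> x y /asboolP/closureP cx /asboolP/closureP cy.
  apply/asboolP/closureP => e e0.
  have e2 : 0 < e / 2 by rewrite divr_gt0.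
  have [x' [s ->] xs] := cx _ e2; have [y' [t ->] yt] := cy _ e2.
  eexists; first by exists (s ++ t).
  rewrite big_cat/= opprD addrACA (splitr e).
  by rewrite (le_lt_trans (ler_normD _ _))// ltrD.
- move=> a x /asboolP/closureP cx; apply/asboolP/closureP => e e0.
  have a1 : 0 < `|a| + 1 by rewrite ltr_wpDl.
  have [x' [s ->] xs] := cx (e / (`|a| + 1)) (divr_gt0 e0 a1).
  eexists; first by exists [seq (a * p.1, p.2) | p <- s].
  rewrite big_map/=; under eq_bigr do rewrite -scalerA.
  rewrite -scaler_sumr -scalerBr normrZ.
  rewrite ltr_pdivlMr// mulrC in xs; apply: le_lt_trans xs.
  by rewrite ler_wpM2r// lerDl.
Qed.

HB.instance Definition _ :=
  GRing.isSubmodClosed.Build R V is_closed_span closed_span_closed.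
HB.instance Definition _ := [SubChoice_isSubLmodule of closed_span by <:].

Definition closed_span_norm (x : closed_span) : R := `|closed_span_val x|.

Lemma closed_span_normD x y :
  closed_span_norm (x + y) <= closed_span_norm x + closed_span_norm y.
Proof. exact: ler_normD. Qed.

Lemma closed_span_normZ a x :
  closed_span_norm (a *: x) = `|a| * closed_span_norm x.
Proof. exact: normrZ. Qed.

Lemma closed_span_norm_eq0 x : closed_span_norm x = 0 -> x = 0.
Proof. by move=> /normr0_eq0 x0; exact: val_inj. Qed.

HB.instance Definition _ := Lmodule_isNormed.Build R closed_span
  closed_span_normD closed_span_normZ closed_span_norm_eq0.

Lemma closed_span_normE (x : closed_span) : `|x| = `|closed_span_val x|.
Proof. by []. Qed.

End closed_span.

Section dual.
Variables (R : realType) (V : normedModType R).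

Definition is_dual : {pred V -> R^o} :=
  fun phi => `[< scalar phi /\ continuous phi >].

Record dual := Dual { dual_fun :> V -> R^o ; _ : dual_fun \in is_dual }.

HB.instance Definition _ := [isSub for dual_fun].
HB.instance Definition _ := [Choice of dual by <:].

Lemma dual_closed : subsemimod_closed is_dual.
Proof.
split; first split.
- apply/asboolP; split=> [a x y|x]; first by rewrite mulr0 addr0.
  exact: cvg_cst.
- move=> f g /asboolP[fl fc] /asboolP[gl gc]; apply/asboolP; split.
    by move=> a x y; change (f (a *: x + y) + g (a *: x + y) = a * (f x + g x) + (f y + g y));
      rewrite fl gl mulrDr addrACA.
  by move=> x; apply: cvgD; [exact: fc|exact: gc].
- move=> a f /asboolP[fl fc]; apply/asboolP; split.
    move=> b x y; change (a * f (b *: x + y) = b * (a * f x) + a * f y).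
    by rewrite fl mulrDr mulrCA.
  by move=> x; apply: cvgZr; exact: fc.
Qed.

HB.instance Definition _ :=
  GRing.isSubmodClosed.Build R (V -> R^o) is_dual dual_closed.
HB.instance Definition _ := [SubChoice_isSubLmodule of dual by <:].

Definition dual_norm (phi : dual) : R :=
  sup [set `|phi x| | x in [set x : V | `|x| <= 1]].

Let dual_bnd (phi : dual) : exists2 M, 0 <= M & forall x, `|phi x| <= M * `|x|.
Proof.
case: phi => f /= /asboolP[fl fc].
pose fL := GRing.isLinear.Build R V R^o *%R f fl.
pose F : {linear V -> R^o} := HB.pack f fL.
have /linear_boundedP/pinfty_ex_gt0[M M0 FM] : bounded_near F (nbhs 0).
  by apply/linear_bounded_continuous.
by exists M => //; exact: ltW.
Qed.

Let dualZ (phi : dual) a x : phi (a *: x) = a * phi x.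
Proof.
case: phi => f /= /asboolP[fl _].
have f0 : f 0 = 0 by have := fl (-1) 0 0; rewrite scaler0 addr0 mulN1r addNr.
by have := fl a x 0; rewrite f0 !addr0.
Qed.

Lemma dual_norm_ub (phi : dual) x : `|phi x| <= dual_norm phi * `|x|.
Proof.
have [x0|x0] := eqVneq x 0.
  by rewrite x0 -(scale0r x) dualZ mul0r scale0r !normr0 mulr0.
have nx : 0 < `|x| by rewrite normr_gt0.
rewrite -ler_pdivrMr//; apply: ub_le_sup.
  have [M M0 fM] := dual_bnd phi; exists M => _ [y /= y1 <-].
  by rewrite (le_trans (fM _))// ler_piMr.
exists (`|x|^-1 *: x) => /=.
  by rewrite normrZ normfV normr_id mulVf// gt_eqF.
by rewrite dualZ normrM normfV normr_id mulrC.
Qed.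

Lemma dual_norm_le (phi : dual) (M : R) :
  (forall x, `|x| <= 1 -> `|phi x| <= M) -> dual_norm phi <= M.
Proof.
move=> fM; apply: ge_sup; last by move=> _ [x x1 <-]; exact: fM.
by exists `|phi 0|, 0 => //=; rewrite normr0.
Qed.

Lemma dual_norm_ge0 (phi : dual) : 0 <= dual_norm phi.
Proof.
apply: (@le_trans _ _ `|phi 0|) => //; apply: ub_le_sup.
  have [M M0 fM] := dual_bnd phi; exists M => _ [y /= y1 <-].
  by rewrite (le_trans (fM _))// ler_piMr.
by exists 0 => //=; rewrite normr0.
Qed.

Lemma dual_normD (f g : dual) : dual_norm (f + g) <= dual_norm f + dual_norm g.
Proof.
apply: dual_norm_le => x x1; rewrite (le_trans (ler_normD _ _))// lerD//.
  by rewrite (le_trans (dual_norm_ub _ _))// ler_piMr// dual_norm_ge0.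
by rewrite (le_trans (dual_norm_ub _ _))// ler_piMr// dual_norm_ge0.
Qed.

Let dual_normZ_le a (f : dual) : dual_norm (a *: f) <= `|a| * dual_norm f.
Proof.
apply: dual_norm_le => x x1; rewrite normrM ler_wpM2l//.
by rewrite (le_trans (dual_norm_ub _ _))// ler_piMr// dual_norm_ge0.
Qed.

Lemma dual_normZ a (f : dual) : dual_norm (a *: f) = `|a| * dual_norm f.
Proof.
apply/eqP; rewrite eq_le dual_normZ_le/=.
have [->|a0] := eqVneq a 0; first by rewrite normr0 mul0r dual_norm_ge0.
rewrite -ler_pdivlMl ?normr_gt0// -normfV.
by rewrite -{1}[f](scalerK a0) dual_normZ_le.
Qed.

Lemma dual_norm_eq0 (f : dual) : dual_norm f = 0 -> f = 0.
Proof.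
move=> f0; apply/val_inj/funext => x /=; apply/eqP.
by rewrite -normr_le0 (le_trans (dual_norm_ub _ _))// f0 mul0r.
Qed.

HB.instance Definition _ :=
  Lmodule_isNormed.Build R dual dual_normD dual_normZ dual_norm_eq0.

Lemma dual_normE (phi : dual) : `|phi| = dual_norm phi. Proof. by []. Qed.

End dual.

Definition isomorphism (R : realType) (V W : normedModType R)
    (J : {linear V -> W}) : Prop :=
  continuous J /\
  exists K : W -> V, [/\ cancel J K, cancel K J & continuous K].

(* The sum of g t * x t over t, an absolutely convergent sum over the index
   set T, as the difference of the sums of its positive and negative parts. *)
Definition pairing (R : realType) (T : choiceType)
    (g : l1 R T) (x : linf R T) : R :=
  let h t := (g t * x t)%:E in
  fine (esum [set: T] h^\+ - esum [set: T] h^\-)%E.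

(* Sequences (m_j), (n_j) are indexed by j >= 1; the values at 0 are unused. *)
Record weight_seqs (m n : nat -> nat) : Prop := WeightSeqs {
  ws_n_gt0 : forall j, (1 <= j)%N -> (1 <= n j)%N ;
  ws_m1 : (4 <= m 1)%N ;
  ws_m : forall j, (1 <= j)%N -> (m j ^ 2 <= m j.+1)%N ;
  ws_n : forall j, (1 <= j)%N ->
    (m j.+1 ^ 2 * (4 * n j) ^ (2 ^ j.+1) <= n j.+1)%N }.

(* The possible forms of an element of Gamma: the unique element of Delta_1,
   (k, w, b) and (k, xi, w, b).  The entries xi and b refer to Gamma itself, so
   Gamma is given as a type G with an injective map code : G -> bd_tuple
   identifying each of its elements with a tuple. *)
Inductive bd_tuple (R : realType) (G : choiceType) : Type :=
| Elt1
| Type1 of nat & R & l1 R G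
| Type2 of nat & G & R & l1 R G.

Arguments Elt1 {R G}.

Section BD.
Variables (R : realType) (G : choiceType) (code : G -> bd_tuple R G).

Definition rank (g : G) : nat :=
  match code g with
  | Elt1 => 1%N
  | Type1 k _ _ => k
  | Type2 k _ _ _ => k
  end.

Definition weight (g : G) : option R :=
  match code g with
  | Elt1 => None
  | Type1 _ w _ => Some w^-1
  | Type2 _ _ w _ => Some w^-1
  end.

Definition Delta (k : nat) : set G := [set g | rank g = k].

Definition Gamma (k : nat) : set G :=
  \bigcup_(p in [set p | (1 <= p <= k)%N]) Delta p.

(* The age of the element of Delta_1 is irrelevant and left unspecified. *)
Record bd_set (age : G -> nat) : Prop := BdSet {
  bd_code_inj : injective code ;
  bd_rank_gt0 : forall g, (1 <= rank g)%N ;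
  bd_Delta1 : exists g1, code g1 = Elt1 /\ Delta 1 = [set g1] ;
  bd_Delta_finite : forall k, finite_set (Delta k) ;
  bd_age1 : forall g k w b, code g = Type1 k w b -> age g = 1%N ;
  bd_age2 : forall g k xi w b, code g = Type2 k xi w b -> age g = (age xi).+1 }.

(* The unit ball of l1(A), as a subset of l1(G). *)
Definition l1_ball (A : set G) : set (l1 R G) :=
  [set b : l1 R G | (forall g, ~ A g -> b g = 0) /\ `|b| <= 1].

Definition Bnet (N : nat -> nat) (k p : nat) : set (l1 R G) :=
  [set b : l1 R G | l1_ball (Gamma k `\` Gamma p) b /\
    forall g, exists q : rat, b g = ratr q /\ (`|denq q| %| (N k)`!)%N].

Record net_seq (N : nat -> nat) : Prop := NetSeq {
  net_gt0 : forall k, (1 <= k)%N -> (1 <= N k)%N ;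
  net_incr : forall k, (1 <= k)%N -> (N k <= N k.+1)%N ;
  net_net : forall k p, (p < k)%N ->
    forall f, l1_ball (Gamma k `\` Gamma p) f ->
    exists2 b, Bnet N k p b & `|f - b| <= 2 ^- k }.

Section assumptions.
Variables (m n N : nat -> nat) (age : G -> nat).

Definition upper_assumption : Prop :=
  forall k, (1 <= k)%N -> forall g, Delta k.+1 g ->
    (exists j b, [/\ (1 <= j <= k.+1)%N, Bnet N k 0 b &
       code g = Type1 k.+1 (m j)%:R^-1 b]) \/
    (exists p j xi b,
       [/\ (0 < p < k)%N, (1 <= j <= p)%N & Delta p xi] /\
       [/\ weight xi = Some (m j)%:R, (age xi < n j)%N, Bnet N k p b &
           code g = Type2 k.+1 xi (m j)%:R^-1 b]).

Definition lower_assumption : Prop :=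
  forall k, (1 <= k)%N ->
    (forall j b, (1 <= j <= k.+1 %/ 2)%N -> Bnet N k 0 b ->
       exists2 g, Delta k.+1 g & code g = Type1 k.+1 (m (2 * j))%:R^-1 b) /\
    (forall p j xi b, (1 <= p < k)%N -> (1 <= j <= p %/ 2)%N -> Delta p xi ->
       weight xi = Some (m (2 * j))%:R -> (age xi < n (2 * j))%N ->
       Bnet N k p b ->
       exists2 g, Delta k.+1 g & code g = Type2 k.+1 xi (m (2 * j))%:R^-1 b).

End assumptions.

(* Here P q is the projection P^*_{(0,q]}. *)
Definition cstar (P : nat -> {linear l1 R G -> l1 R G}) (g : G) : l1 R G :=
  match code g with
  | Elt1 => 0
  | Type1 _ w b => w *: b
  | Type2 _ xi w b => l1_unit R xi + w *: (b - P (rank xi) b)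
  end.

Record bd_functionals (dstar : G -> l1 R G)
    (P : nat -> {linear l1 R G -> l1 R G}) : Prop := BdFunctionals {
  bd_P_bounded : forall q, continuous (P q) ;
  bd_P_proj : forall q f, P q (P q f) = P q f ;
  bd_P0 : forall f, P 0 f = 0 ;
  bd_P_in : forall q g, Gamma q g -> P q (dstar g) = dstar g ;
  bd_P_out : forall q g, ~ Gamma q g -> P q (dstar g) = 0 ;
  bd_dstar : forall g, dstar g = l1_unit R g - cstar P g }.

End BD.

Definition biorthogonal (R : realType) (T : choiceType)
    (dstar : T -> l1 R T) (d : T -> linf R T) : Prop :=
  forall s t, pairing (dstar s) (d t) = (s == t)%:R.

(* Main.v *)
Require Import Defs.
From HB Require Import structures.
From mathcomp Require Import all_boot all_order all_algebra finmap lra.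
From mathcomp Require Import all_classical all_reals all_analysis.

Import numFieldNormedType.Exports.

Set Implicit Arguments.
Unset Strict Implicit.
Unset Printing Implicit Defensive.

Import Order.TTheory GRing.Theory Num.Theory.

Local Open Scope classical_set_scope.
Local Open Scope ring_scope.

(** The evaluation map sends g to the functional x |-> sum of g(t) x(t).  It is
bounded, and it is bounded below because every function on the finite set
Gamma_q extends to an element of X(Gamma) of at most twice its norm
([block_extension], [initial_bound]): extending the signs of g gives
[norm_le_evaluation].  The point is surjectivity.

Call a finite combination of the vectors d_s with p < rank s <= q a block on
(p, q].  Given a functional phi, its heads, that is the sums of
phi(d_s) dstar_s over the s of rank at most q, lie in l1, and they converge to
phi in norm as soon as phi is uniformly small on the unit blocks on (p, q] for
large p ([head_close]); since l1 is complete and evaluation is bounded below,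
the limit is then an evaluation ([evaluation_surjective]).  So everything rests
on [shrinking]: a functional on X(Gamma) is small on blocks that start late.

Suppose on the contrary that phi(x_k) >= eps for a bounded sequence of
successive blocks x_k.  Call the sequence sparse if, for some constant D and
every element g of weight w, all but one of the values x_k(g) are at most D/w.
For a sparse sequence, averages of M consecutive terms have half the norm when
M is large ([average_halves]).  At elements of large weight this is sparseness.
At an element g of small weight m_j it comes from unfolding the recursive
definition of g: this involves at most n_j elements, and a block whose interval
contains none of their ranks takes at g a value at most 1/m_j <= 1/4 times its
norm ([analysis_ranks]).  The averages are again sparse, with the same D, and
phi is still at least eps on them.  Iterating contradicts the boundedness of
phi ([sparse_not_bounded_below]).

Arbitrary blocks reduce to sparse ones by splitting.  A block that vanishes on
the elements of weight m_j in its own initial segment Gamma_q has values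
O(1/m_j) at all elements of weight m_j ([coord_foreign_weight]).  Hence blocks
whose weights in this local sense are bounded form sparse sequences
([small_on_bounded_weights]), and so do blocks whose local weights grow faster
than their ranks.  In [shrinking] each block is cut into a part of the first
kind, on which phi is small, and a part of the second kind. *)

(** * Absolutely convergent sums and the pairing *)

Section absolutely_convergent_sums.
Variables (R : realType) (T : choiceType).
Implicit Types (f g u v : l1 R T) (x : linf R T).

Definition nonneg_l1 f := forall t, 0 <= f t.

Lemma l1_sumE f : (\esum_(t in [set: T]) `|(f t)%:E| = `|f|%:E)%E.
Proof. by rewrite l1_normE /l1_norm fineK // l1_fin. Qed.

Lemma nonneg_l1_sum f : nonneg_l1 f ->
  (\esum_(t in [set: T]) (f t)%:E = `|f|%:E)%E.
Proof.
move=> f0; rewrite -l1_sumE; apply: eq_esum => t _.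
by rewrite gee0_abs // lee_fin.
Qed.

Lemma ler_l1_norm f g (A : R) : 0 <= A ->
  (forall t, `|f t| <= A * `|g t|) -> `|f| <= A * `|g|.
Proof.
move=> A0 fg; have -> : A * `|g| = `|A *: g| by rewrite normrZ ger0_norm.
rewrite -lee_fin -!l1_sumE; apply: le_esum => t _.
by rewrite !abse_EFin lee_fin normrM (ger0_norm A0).
Qed.

Lemma nonneg_l1D u v : nonneg_l1 u -> nonneg_l1 v -> nonneg_l1 (u + v).
Proof. by move=> u0 v0 t; change (0 <= u t + v t); exact: addr_ge0. Qed.

Lemma nonneg_l1Z a u : 0 <= a -> nonneg_l1 u -> nonneg_l1 (a *: u).
Proof. by move=> a0 u0 t; change (0 <= a * u t); exact: mulr_ge0. Qed.

Lemma l1_norm_nonnegD u v : nonneg_l1 u -> nonneg_l1 v ->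
  `|u + v| = `|u| + `|v|.
Proof.
move=> u0 v0; apply: EFin_inj; rewrite EFinD.
rewrite -!nonneg_l1_sum //; last exact: nonneg_l1D.
by rewrite -esumD // => t _; rewrite lee_fin.
Qed.

Definition signed_sum (h : T -> R) : R :=
  fine (esum [set: T] (EFin \o h)^\+ - esum [set: T] (EFin \o h)^\-)%E.

Lemma summable_l1 f : summable [set: T] (EFin \o f).
Proof. by rewrite /summable l1_sumE ltry. Qed.

(** Every decomposition of a family into two nonnegative summable ones computes
its sum, so linearity below only requires choosing decompositions. *)
Lemma signed_sumB u v : nonneg_l1 u -> nonneg_l1 v ->
  signed_sum (u - v) = `|u| - `|v|.
Proof.
move=> u0 v0; rewrite /signed_sum.
have -> : EFin \o (u - v : l1 R T) = ((EFin \o u) \- (EFin \o v))%E.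
  by apply/funext => t /=; rewrite -EFinB.
rewrite (@esumB R T) ?(nonneg_l1_sum u0) ?(nonneg_l1_sum v0) //.
- exact: summable_l1.
- exact: summable_l1.
- by move=> t _; rewrite lee_fin.
- by move=> t _; rewrite lee_fin.
Qed.

(** The norm splits because the two parts have disjoint supports. *)
Lemma l1_pos_part f : exists u v,
  [/\ nonneg_l1 u, nonneg_l1 v, f = u - v & `|f| = `|u| + `|v|].
Proof.
have mem (h : R -> R) : (forall y, `|h y| <= `|y|) ->
    (fun t => h (f t)) \in @is_l1 R T.
  move=> hle; apply/asboolP; apply: le_lt_trans (summable_l1 f).
  by apply: le_esum => t _; rewrite lee_fin.
have pmem : (fun t => Num.max (f t) 0) \in @is_l1 R T.
  apply: (mem (Num.max^~ 0)) => y.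
  by case: (leP y 0) => y0; rewrite ?normr0 // normr_ge0.
have nmem : (fun t => Num.max (- f t) 0) \in @is_l1 R T.
  apply: (mem (fun y => Num.max (- y) 0)) => y.
  by case: (leP (- y) 0) => y0; rewrite ?normr0 ?normrN // normr_ge0.
have u0 : nonneg_l1 (L1 pmem) by move=> t; rewrite /= le_max lexx orbT.
have v0 : nonneg_l1 (L1 nmem) by move=> t; rewrite /= le_max lexx orbT.
exists (L1 pmem), (L1 nmem); split=> //.
  apply/val_inj/funext => t /=.
  change (f t = Num.max (f t) 0 - Num.max (- f t) 0).
  case: (leP (f t) 0) => f0; case: (leP (- f t) 0) => nf0;
    rewrite ?subr0 ?sub0r ?opprK //.
    by apply/eqP; rewrite eq_le f0 -oppr_le0.
  by move: nf0; rewrite oppr_gt0 ltNge (ltW f0).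
rewrite -l1_norm_nonnegD //; apply: EFin_inj; rewrite -!l1_sumE.
apply: eq_esum => t _; congr EFin.
change (`|f t| = `|Num.max (f t) 0 + Num.max (- f t) 0|).
case: (leP (f t) 0) => f0; case: (leP (- f t) 0) => nf0;
    rewrite ?addr0 ?add0r ?normrN //.
  by apply/eqP; rewrite normr0 normr_eq0 eq_le f0 -oppr_le0.
by move: nf0; rewrite oppr_gt0 ltNge (ltW f0).
Qed.

Lemma signed_sum_le f : `|signed_sum f| <= `|f|.
Proof.
have [u [v [u0 v0 -> ->]]] := l1_pos_part f.
by rewrite signed_sumB // (le_trans (ler_normB _ _)) // !normr_id.
Qed.

Lemma signed_sumD f g : signed_sum (f + g) = signed_sum f + signed_sum g.
Proof.
have [u [v [u0 v0 -> _]]] := l1_pos_part f.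
have [u' [v' [u0' v0' -> _]]] := l1_pos_part g.
rewrite addrACA -opprD !signed_sumB //.
- by rewrite !l1_norm_nonnegD // opprD addrACA.
- exact: nonneg_l1D.
- exact: nonneg_l1D.
Qed.

Lemma signed_sumZ a f : signed_sum (a *: f) = a * signed_sum f.
Proof.
have [u [v [u0 v0 -> _]]] := l1_pos_part f.
rewrite [in RHS]signed_sumB //; case: (leP 0 a) => a0.
  rewrite scalerBr signed_sumB ?normrZ ?ger0_norm ?mulrBr //.
    exact: nonneg_l1Z.
  exact: nonneg_l1Z.
have -> : a *: (u - v) = (- a) *: v - (- a) *: u.
  by rewrite scalerBr !scaleNr opprK addrC.
have na0 : 0 <= - a by rewrite oppr_ge0 ltW.
rewrite signed_sumB ?normrZ ?(ger0_norm na0); last 2 first.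
- exact: nonneg_l1Z.
- exact: nonneg_l1Z.
by rewrite !mulNr opprK addrC -mulrBr.
Qed.

End absolutely_convergent_sums.

Section pairing_theory.
Variables (R : realType) (T : choiceType).
Implicit Types (f g : l1 R T) (x y : linf R T).

Lemma l1_mul_mem g x : (fun t => g t * x t) \in @is_l1 R T.
Proof.
apply/asboolP; rewrite /summable.
have := summable_l1 (`|x| *: g); apply: le_lt_trans; apply: le_esum => t _.
rewrite lee_fin; change (`|g t * x t| <= (`|(`|x| * g t)|)).
by rewrite !normrM normr_id mulrC ler_wpM2r // linf_norm_ub.
Qed.

Definition l1_mul g x : l1 R T := L1 (l1_mul_mem g x).

Lemma pairingE g x : pairing g x = signed_sum (l1_mul g x).
Proof. by []. Qed.

Lemma pairing_linl x : scalar (fun g : l1 R T => pairing g x : R^o).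
Proof.
move=> a f g; rewrite !pairingE -signed_sumZ -signed_sumD; congr signed_sum.
apply/funext => t; change ((a * f t + g t) * x t = a * (f t * x t) + g t * x t).
by rewrite mulrDl mulrA.
Qed.

Lemma pairing_linr g : scalar (fun x : linf R T => pairing g x : R^o).
Proof.
move=> a x y; rewrite !pairingE -signed_sumZ -signed_sumD; congr signed_sum.
apply/funext => t; change (g t * (a * x t + y t) = a * (g t * x t) + g t * y t).
by rewrite mulrDr mulrCA.
Qed.

(** The bound on x is only asked for on the support of g: in the inductions on
the rank, x is controlled on the support of the functionals before it is
controlled elsewhere. *)
Lemma pairing_le g x (A : R) : 0 <= A ->
  (forall t, g t != 0 -> `|x t| <= A) -> `|pairing g x| <= A * `|g|.
Proof.
move=> A0 xA; rewrite pairingE (le_trans (signed_sum_le _)) //.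
apply: ler_l1_norm => // t; change (`|g t * x t| <= A * `|g t|).
have [->|gt] := eqVneq (g t) 0; first by rewrite mul0r normr0 mulr0.
by rewrite normrM mulrC ler_wpM2r // xA.
Qed.

Lemma pairing_norm g x : `|pairing g x| <= `|x| * `|g|.
Proof. by apply: pairing_le => // t _; exact: linf_norm_ub. Qed.

Lemma l1_unit_norm (s : T) : `|l1_unit R s| = 1.
Proof.
apply: EFin_inj; rewrite -l1_sumE (esumID [set s]) // setTI.
rewrite [X in (_ + X)%E]esum1 ?adde0.
  by rewrite esum_set1 //= /l1_unit_fun eqxx normr1.
by move=> t [_ /eqP] /=; rewrite /l1_unit_fun => /negbTE ->; rewrite normr0.
Qed.

Lemma pairing_unit (s : T) x : pairing (l1_unit R s) x = x s.
Proof.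
have u0 : nonneg_l1 (l1_unit R s) by move=> t; rewrite ler0n.
rewrite pairingE.
have -> : l1_mul (l1_unit R s) x = x s *: l1_unit R s.
  apply/val_inj/funext => t /=.
  change ((t == s)%:R * x t = x s * (t == s)%:R).
  by have [->|_] := eqVneq t s; rewrite ?mulr1 ?mul1r // mulr0 mul0r.
rewrite signed_sumZ -[l1_unit R s]subr0 signed_sumB //.
by rewrite normr0 subr0 l1_unit_norm mulr1.
Qed.

End pairing_theory.

Section pairing_linear.
Variables (R : realType) (T : choiceType).
Implicit Types (f g : l1 R T) (x y : linf R T).

Lemma pairingDl f g x : pairing (f + g) x = pairing f x + pairing g x.
Proof. by rewrite -[f]scale1r pairing_linl mul1r scale1r. Qed.

Lemma pairing0l x : pairing (0 : l1 R T) x = 0.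
Proof. by apply: (addrI (pairing 0 x)); rewrite -pairingDl !addr0. Qed.

Lemma pairingZl a f x : pairing (a *: f) x = a * pairing f x.
Proof. by rewrite -[a *: f]addr0 pairing_linl pairing0l addr0. Qed.

Lemma pairingBl f g x : pairing (f - g) x = pairing f x - pairing g x.
Proof. by rewrite -scaleN1r pairingDl pairingZl mulN1r. Qed.

Lemma pairing_suml I (r : seq I) (Q : pred I) (F : I -> l1 R T) x :
  pairing (\sum_(i <- r | Q i) F i) x = \sum_(i <- r | Q i) pairing (F i) x.
Proof.
exact: (big_morph (fun f => pairing f x)
  (fun f g => pairingDl f g x) (pairing0l x)).
Qed.

Lemma pairingDr g x y : pairing g (x + y) = pairing g x + pairing g y.
Proof. by rewrite -[x]scale1r pairing_linr mul1r scale1r. Qed.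

Lemma pairing0r g : pairing g (0 : linf R T) = 0.
Proof. by apply: (addrI (pairing g 0)); rewrite -pairingDr !addr0. Qed.

Lemma pairingZr g a x : pairing g (a *: x) = a * pairing g x.
Proof. by rewrite -[a *: x]addr0 pairing_linr pairing0r addr0. Qed.

Lemma pairingBr g x y : pairing g (x - y) = pairing g x - pairing g y.
Proof. by rewrite -scaleN1r pairingDr pairingZr mulN1r. Qed.

Lemma l1_fun_sum I (r : seq I) (F : I -> l1 R T) t :
  (\sum_(i <- r) F i) t = \sum_(i <- r) F i t.
Proof. exact: (big_morph (fun f : l1 R T => f t) (fun _ _ => erefl) erefl). Qed.

Lemma l1_finite_support (A : set T) f : finite_set A ->
  (forall t, f t != 0 -> A t) ->
  f = \sum_(s <- fset_set A) f s *: l1_unit R s.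
Proof.
move=> finA fA; apply/val_inj/funext => t; rewrite /= l1_fun_sum.
have E s : (f s *: l1_unit R s) t = f s * (t == s)%:R by [].
under eq_bigr do rewrite E.
have [/eqP ft0|ft0] := boolP (f t == 0).
  rewrite big1 // => s _; have [<-|_] := eqVneq t s; last by rewrite mulr0.
  by rewrite ft0 mul0r.
have tA : t \in fset_set A by rewrite in_fset_set // inE; exact: fA.
rewrite (bigD1_seq t) //= eqxx mulr1 big1 ?addr0 // => s st.
by rewrite eq_sym (negbTE st) mulr0.
Qed.

End pairing_linear.

(** * Truncation, finite sums and completeness in l1 *)

Section l1_finite_sums.
Variables (R : realType) (T : choiceType).
Implicit Types (f g : l1 R T) (A : set T).

Definition partial_norm (h : T -> R) A : R := \sum_(t <- fset_set A) `|h t|.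

Lemma partial_normE (h : T -> R) A : finite_set A ->
  (partial_norm h A)%:E = (\sum_(t \in A) `|(h t)%:E|)%E.
Proof. by move=> fA; rewrite fsbig_finite // /partial_norm sumEFin. Qed.

Lemma partial_norm_le f A : finite_set A -> partial_norm f A <= `|f|.
Proof.
move=> fA; rewrite -lee_fin -l1_sumE partial_normE //.
by apply: esum_ge; exists A.
Qed.

Lemma l1_of_partial_norms (h : T -> R) (B : R) :
  (forall A, finite_set A -> partial_norm h A <= B) ->
  exists f, (forall t, f t = h t) /\ `|f| <= B.
Proof.
move=> hB.
have sumB : (\esum_(t in [set: T]) `|(h t)%:E| <= B%:E)%E.
  apply: ge_ereal_sup => _ [A [fA _] <-]; rewrite -partial_normE // lee_fin.
  exact: hB.
have mem : (h : T -> R^o) \in @is_l1 R T.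
  by apply/asboolP; apply: le_lt_trans sumB _; rewrite ltry.
by exists (L1 mem); split=> //; rewrite -lee_fin -l1_sumE.
Qed.

Lemma partial_norm_adherent f (e : R) : 0 < e ->
  exists2 A, finite_set A & `|f| - e < partial_norm f A.
Proof.
move=> e0.
have [|_ [A [fA _] <-]] := @ub_ereal_sup_adherent R
    [set (\sum_(t \in A) `|(f t)%:E|)%E | A in fsets [set: T]] e e0.
  by rewrite -[ereal_sup _]/(\esum_(t in [set: T]) `|(f t)%:E|)%E l1_sumE.
rewrite -[ereal_sup _]/(\esum_(t in [set: T]) `|(f t)%:E|)%E l1_sumE.
by rewrite -partial_normE // -EFinB lte_fin => ltA; exists A.
Qed.

(** The parts of f on and off A have disjoint supports, so their norms add up;
hence f2 is small as soon as A carries most of the norm of f. *)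
Lemma l1_restrict A f : exists f1 f2 : l1 R T,
  [/\ f = f1 + f2, `|f| = `|f1| + `|f2|, forall t, A t -> f1 t = f t &
      forall t, ~ A t -> f1 t = 0].
Proof.
pose h (B : set T) t : R := if t \in B then f t else 0.
have [f1 [f1h _]] : exists g, (forall t, g t = h A t) /\ `|g| <= `|f|.
  apply: l1_of_partial_norms => B fB; apply: le_trans (partial_norm_le f fB).
  by apply: ler_sum => t _; rewrite /h; case: ifP => // _; rewrite normr0.
exists f1, (f - f1).
have f1A t : A t -> f1 t = f t by move=> At; rewrite f1h /h mem_set.
have f1N t : ~ A t -> f1 t = 0 by move=> At; rewrite f1h /h memNset.
split=> //; first by rewrite addrC subrK.
apply: EFin_inj; rewrite EFinD -!l1_sumE -esumD //; apply: eq_esum => t _.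
rewrite !abse_EFin -EFinD; congr EFin.
change (`|f t| = `|f1 t| + `|f t - f1 t|).
have [/f1A ->|/f1N ->] := pselect (A t); first by rewrite subrr normr0 addr0.
by rewrite normr0 subr0 add0r.
Qed.

Lemma l1_coord_le f t : `|f t| <= `|f|.
Proof.
apply: le_trans (partial_norm_le f (finite_set1 t)).
by rewrite /partial_norm fset_set1 big_seq_fset1.
Qed.

(** The limit is the pointwise limit h of u.  Bounds on the finite partial norms
of u i - u j pass to the limit in j, which bounds the norm of u i - h; in
particular h is summable. *)
Lemma l1_complete (u : nat -> l1 R T) :
  (forall e : R, 0 < e -> exists k, forall i j, (k <= i)%N -> (k <= j)%N ->
    `|u i - u j| <= e) ->
  exists g, forall e : R, 0 < e -> exists k, forall i, (k <= i)%N ->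
    `|u i - g| <= e.
Proof.
move=> uC.
have ucvg t : cvg (u i t @[i --> \oo]).
  apply/cauchy_cvgP/cauchy_ballP => e e0; near_simpl.
  have [|k ke] := uC (e / 2); first by rewrite divr_gt0.
  near=> i j; rewrite -ball_normE /=.
  apply: (@le_lt_trans _ _ (e / 2)); last by rewrite gtr_pMr // invf_lt1 ?ltr1n.
  apply: le_trans (ke i j _ _).
  - exact: (l1_coord_le (u i - u j)).
  - by near: i; exists k.
  - by near: j; exists k.
pose h t : R := lim (u i t @[i --> \oo]).
have bound e k : (forall i j, (k <= i)%N -> (k <= j)%N -> `|u i - u j| <= e) ->
    forall i, (k <= i)%N -> forall A, finite_set A ->
    partial_norm (fun t => u i t - h t) A <= e.
  move=> ke i ki A fA.
  have cA : partial_norm (u i - u j) A @[j --> \oo] -->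
      partial_norm (fun t => u i t - h t) A.
    rewrite /partial_norm.
    apply: (@cvg_big _ _ +%R); first exact: add_continuous.
    move=> t _; apply: cvg_norm; apply: cvgB; first exact: cvg_cst.
    exact: ucvg.
  apply: (cvgr_to_le cA); near=> j.
  apply: (le_trans (partial_norm_le _ fA)); apply: ke => //.
  by near: j; exists k.
have [k k1] := uC 1 ltr01.
have [g0 [g0h _]] := l1_of_partial_norms (bound _ _ k1 k (leqnn k)).
exists (u k - g0) => e e0; have [l le] := uC e e0; exists l => i li.
have [g [gh gle]] := l1_of_partial_norms (bound _ _ le i li).
suff -> : u i - (u k - g0) = g by [].
apply/val_inj/funext => t /=; rewrite gh.
change (u i t - (u k t - g0 t) = u i t - h t).
by rewrite g0h subKr.
Unshelve. all: by end_near. Qed.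

End l1_finite_sums.

(** * Linear spans and coordinates *)

Section linear_span.
Variables (R : realType) (V : normedModType R) (I : Type) (v : I -> V).

Lemma lin_span0 : lin_span v 0.
Proof. by exists [::]; rewrite big_nil. Qed.

Lemma lin_span_gen i : lin_span v (v i).
Proof. by exists [:: (1, i)]; rewrite big_seq1 scale1r. Qed.

Lemma lin_spanD x y : lin_span v x -> lin_span v y -> lin_span v (x + y).
Proof. by move=> [r ->] [s ->]; exists (r ++ s); rewrite big_cat. Qed.

Lemma lin_spanZ a x : lin_span v x -> lin_span v (a *: x).
Proof.
move=> [r ->]; exists [seq (a * u.1, u.2) | u <- r].
by rewrite big_map scaler_sumr; apply: eq_bigr => u _; rewrite scalerA.
Qed.

Lemma lin_span_sum J (r : seq J) (F : J -> V) :
  (forall j, lin_span v (F j)) -> lin_span v (\sum_(j <- r) F j).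
Proof.
move=> vF; elim: r => [|j r IH]; first by rewrite big_nil; exact: lin_span0.
by rewrite big_cons; apply: lin_spanD.
Qed.

End linear_span.

Section closed_span_values.
Variables (R : realType) (V : normedModType R) (I : Type) (v : I -> V).

Lemma closed_span_valD (x y : closed_span v) :
  closed_span_val (x + y) = closed_span_val x + closed_span_val y.
Proof. by []. Qed.

Lemma closed_span_valZ a (x : closed_span v) :
  closed_span_val (a *: x) = a *: closed_span_val x.
Proof. by []. Qed.

Lemma closed_span_valB (x y : closed_span v) :
  closed_span_val (x - y) = closed_span_val x - closed_span_val y.
Proof. by rewrite -scaleN1r closed_span_valD closed_span_valZ scaleN1r. Qed.

Lemma closed_span_val_comb J (r : seq (R * J)) (F : J -> closed_span v) :
  closed_span_val (\sum_(u <- r) u.1 *: F u.2) =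
  \sum_(u <- r) u.1 *: closed_span_val (F u.2).
Proof. by rewrite (big_morph _ closed_span_valD (erefl _)). Qed.

End closed_span_values.

Lemma closure_norm (R : realType) (V : normedModType R) (A : set V) x (e : R) :
  closure A x -> 0 < e -> exists2 y, A y & `|x - y| < e.
Proof.
move=> cx e0; have [|y [Ay xy]] := cx (ball_ Num.norm x e).
  by apply/nbhs_normP; exists e.
by exists y.
Qed.

Section linf_coordinates.
Variables (R : realType) (T : choiceType).
Implicit Types x y : linf R T.

Lemma linf_funD x y t : (x + y) t = x t + y t.
Proof. by []. Qed.

Lemma linf_funZ a x t : (a *: x) t = a * x t.
Proof. by []. Qed.

End linf_coordinates.

Lemma lipschitz_continuous (R : realType) (V W : normedModType R)
    (f : V -> W) (K : R) :
  (forall x y, `|f x - f y| <= K * `|x - y|) -> continuous f.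
Proof.
move=> fK x; apply/cvgrPdist_lt => e e0.
have K1 : 0 < `|K| + 1 by rewrite ltr_wpDl.
near=> y; apply: (le_lt_trans (fK x y)).
have xy : `|x - y| < e / (`|K| + 1).
  by near: y; apply: cvgr_dist_lt; [exact: cvg_id|exact: divr_gt0].
apply: (@le_lt_trans _ _ ((`|K| + 1) * `|x - y|)).
  by rewrite ler_wpM2r // (le_trans (ler_norm _)) // lerDl.
by rewrite mulrC -ltr_pdivlMr.
Unshelve. all: by end_near. Qed.

(** * Weights and intervals of ranks *)

Section weights.
Variables (m n : nat -> nat).
Hypothesis mn : weight_seqs m n.

Lemma weight_ge4 j : (0 < j)%N -> (4 <= m j)%N.
Proof.
elim: j => // -[_ _|j IH _]; first exact: ws_m1 mn.
apply: leq_trans (IH _) (leq_trans _ (ws_m mn _)) => //.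
by rewrite leq_pmulr // (leq_trans _ (IH _)).
Qed.

Lemma weight_ltS j : (0 < j)%N -> (m j < m j.+1)%N.
Proof.
move=> j0; have m4 := weight_ge4 j0.
rewrite (leq_trans _ (ws_m mn j0)) // ltn_Pmull //; exact: leq_trans m4.
Qed.

Lemma weight_lt i j : (0 < i)%N -> (i < j)%N -> (m i < m j)%N.
Proof.
move=> i0; elim: j => // j IH; rewrite ltnS leq_eqVlt => /predU1P[<-|ij].
  exact: weight_ltS.
by rewrite (ltn_trans (IH ij)) // weight_ltS // (ltn_trans i0).
Qed.

Lemma weight_ge_index j : (0 < j)%N -> (j <= m j)%N.
Proof.
elim: j => // -[_ _|j IH _]; first by rewrite (leq_trans _ (ws_m1 mn)).
exact: leq_ltn_trans (IH _) (weight_ltS _).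
Qed.

Lemma weight_inj i j : (0 < i)%N -> (0 < j)%N -> m i = m j -> i = j.
Proof.
move=> i0 j0 mij; case: (ltngtP i j) => // ij.
  by have := weight_lt i0 ij; rewrite mij ltnn.
by have := weight_lt j0 ij; rewrite mij ltnn.
Qed.

End weights.

Section jumps.
Variable q : nat -> nat.
Hypothesis qS : forall k, (q k <= q k.+1)%N.

(** At most one of the disjoint intervals (q k, q k.+1] contains t; the sharper
right-hand side is what the induction proves. *)
Lemma sum_jumps t M :
  (\sum_(k < M) (q k < t <= q k.+1) <= (q 0 < t <= q M))%N.
Proof.
elim: M => [|M IH]; first by rewrite big_ord0.
have q0M : (q 0 <= q M)%N.
  by elim: M {IH} => // M IH; exact: leq_trans IH (qS _).
rewrite big_ord_recr /= (leq_trans (leq_add IH (leqnn _))) //.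
have [tM|Mt] := leqP t (q M).
  by rewrite addn0 (leq_trans tM (qS M)).
by rewrite andbF add0n (leq_ltn_trans q0M Mt).
Qed.

Lemma sum_count_jumps (r : seq nat) M :
  (\sum_(k < M) count (fun t => q k < t <= q k.+1)%N r <= size r)%N.
Proof.
elim: r => [|t r IH] /=; first by rewrite big1.
rewrite big_split /= -add1n leq_add //.
by rewrite (leq_trans (sum_jumps t M)) // leq_b1.
Qed.

End jumps.

(** * The structure of Gamma and of the biorthogonal vectors *)

Section bd_space.
Variables (R : realType) (m n N : nat -> nat).
Variables (G : choiceType) (code : G -> bd_tuple R G) (age : G -> nat).
Variables (dstar : G -> l1 R G) (P : nat -> {linear l1 R G -> l1 R G}).
Variable d : G -> linf R G.
Hypothesis mn : weight_seqs m n.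
Hypothesis bdG : bd_set code age.
Hypothesis upper : upper_assumption code m n N age.
Hypothesis fnl : bd_functionals code dstar P.
Hypothesis bio : biorthogonal dstar d.

Local Notation rk := (rank code).
Implicit Types (f b : l1 R G) (g s : G).

Lemma GammaE q g : Gamma code q g <-> (rk g <= q)%N.
Proof.
split=> [[p /= /andP[_ pq]]|gq]; first by rewrite /Delta /= => ->.
by exists (rk g) => //=; rewrite (bd_rank_gt0 bdG).
Qed.

Lemma Gamma_finite q : finite_set (Gamma code q).
Proof.
apply: bigcup_finite => [|k _]; last exact: bd_Delta_finite bdG k.
by apply: (sub_finite_set _ (finite_II q.+1)) => k /= /andP[].
Qed.

(** The consequences of the upper assumption: the functional b lies in the unit
ball and is supported on ranks below that of g and, in the second type, above
that of xi; moreover the index j of the weight is at most the rank at which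
the construction of g starts. *)
Inductive element_spec (g : G) : Prop :=
| ElementDelta1 of code g = Elt1 & weight code g = None
| ElementType1 j b of code g = Type1 (rk g) (m j)%:R^-1 b
    & weight code g = Some (m j)%:R & (0 < j)%N & (j <= rk g)%N
    & `|b| <= 1 & (forall t, b t != 0 -> (rk t < rk g)%N)
| ElementType2 j xi b of code g = Type2 (rk g) xi (m j)%:R^-1 b
    & weight code g = Some (m j)%:R & weight code xi = Some (m j)%:R
    & (0 < j)%N & (j <= rk xi)%N
    & (rk xi < rk g)%N & (age xi < n j)%N
    & `|b| <= 1 & (forall t, b t != 0 -> (rk xi < rk t < rk g)%N).

Lemma Bnet_ball k p b : Bnet code N k p b ->
  `|b| <= 1 /\ forall t, b t != 0 -> (p < rk t <= k)%N.
Proof.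
move=> [[b0 b1] _]; split=> // t bt.
have [|tkp] := pselect ((Gamma code k `\` Gamma code p) t).
  by move=> [/GammaE tk tp]; rewrite tk andbT ltnNge; apply/negP => /GammaE.
by rewrite b0 // eqxx in bt.
Qed.

Lemma elementP g : element_spec g.
Proof.
have [k1|k1] := ltnP 1 (rk g); last first.
  have [g1 [cg1 D1]] := bd_Delta1 bdG.
  have : Delta code 1 g.
    by apply/eqP; rewrite eqn_leq k1 (bd_rank_gt0 bdG).
  by rewrite D1 => ->; apply: ElementDelta1; rewrite ?/weight cg1.
have gk : Delta code (rk g).-1.+1 g by rewrite /Delta /= prednK // ltnW.
have k0 : (1 <= (rk g).-1)%N by rewrite -ltnS prednK // ltnW.
have kE : (rk g).-1.+1 = rk g by rewrite prednK // ltnW.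
case: (upper k0 gk); rewrite kE.
  move=> [j [b [/andP[j0 jk] /Bnet_ball[b1 bs] cg]]].
  apply: (ElementType1 cg) => //; first by rewrite /weight cg invrK.
  by move=> t /bs /andP[_]; rewrite -ltnS kE.
move=> [p [j [xi [b [[/andP[p0 pk] /andP[j0 jp]]]]]]].
rewrite /Delta /= => xp [wxi axi /Bnet_ball[b1 bs] cg]; subst p.
apply: (ElementType2 cg) => //; first by rewrite /weight cg invrK.
- by rewrite (leq_trans pk) // leq_pred.
- by move=> t /bs /andP[->]; rewrite -ltnS kE.
Qed.

Lemma rank_ind (Q : G -> Prop) :
  (forall g, (forall t, (rk t < rk g)%N -> Q t) -> Q g) -> forall g, Q g.
Proof.
move=> step g; have [k] := ubnP (rk g); elim: k g => // k IH g gk.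
by apply: step => t tg; apply: IH; rewrite (leq_trans tg).
Qed.

Lemma unit_dstar g : l1_unit R g = dstar g + cstar code P g.
Proof. by rewrite (bd_dstar fnl) subrK. Qed.

Lemma P_span q f : lin_span dstar f -> lin_span dstar (P q f).
Proof.
move=> [s ->]; rewrite raddf_sum; apply: lin_span_sum => -[a g] /=.
rewrite linearZ /=; apply: lin_spanZ.
have [gq|gq] := pselect (Gamma code q g).
  by rewrite (bd_P_in fnl) //; exact: lin_span_gen.
by rewrite (bd_P_out fnl) //; exact: lin_span0.
Qed.

Lemma finite_support_span f k :
  (forall t, f t != 0 -> (rk t < k)%N) ->
  (forall t, (rk t < k)%N -> lin_span dstar (l1_unit R t)) ->
  lin_span dstar f.
Proof.
move=> fk units.
rewrite (l1_finite_support (f := f) (Gamma_finite k.-1)); last first.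
  by move=> t /fk tk; apply/GammaE; rewrite -ltnS prednK // (leq_trans _ tk).
apply: lin_span_sum => t; have [->|ft] := eqVneq (f t) 0.
  by rewrite scale0r; exact: lin_span0.
by apply/lin_spanZ/units/fk.
Qed.

(** By induction on the rank, since cstar g only involves lower ranks.  This is
why the values of P on the vectors dstar determine P on all finitely supported
vectors. *)
Lemma unit_span g : lin_span dstar (l1_unit R g).
Proof.
elim/rank_ind: g => g IH; rewrite unit_dstar.
apply: lin_spanD; first exact: lin_span_gen.
rewrite /cstar.
case: (elementP g) => [-> _|j b -> _ _ _ _ bs|j xi b -> _ _ _ _ xg _ _ bs].
- exact: lin_span0.
- by apply: lin_spanZ; exact: finite_support_span IH.
- have bspan : lin_span dstar b.
    by apply: finite_support_span IH => t /bs /andP[].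
  apply: lin_spanD; first exact: IH.
  apply: lin_spanZ; apply: lin_spanD => //.
  by rewrite -scaleN1r; apply: lin_spanZ; exact: P_span.
Qed.

(** The projection P q is adjoint to dropping the d_s of rank larger than q. *)
Lemma pairing_P f q s k : (forall t, f t != 0 -> (rk t < k)%N) ->
  pairing (P q f) (d s) = if (rk s <= q)%N then pairing f (d s) else 0.
Proof.
move=> fk; have [r ->] : lin_span dstar f.
  by apply: (finite_support_span fk) => t _; exact: unit_span.
rewrite raddf_sum !pairing_suml.
have -> : (if (rk s <= q)%N then \sum_(u <- r) pairing (u.1 *: dstar u.2) (d s)
    else 0) = \sum_(u <- r) if (rk s <= q)%N
      then pairing (u.1 *: dstar u.2) (d s) else 0.
  by case: ifP => // _; rewrite big1.
apply: eq_bigr => u _; rewrite /= linearZ /= !pairingZl !bio.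
have [uq|uq] := pselect (Gamma code q u.2).
  rewrite (bd_P_in fnl) // bio; have [<-|] := eqVneq u.2 s.
    by move/GammaE: uq => ->.
  by rewrite mulr0 if_same.
rewrite (bd_P_out fnl) // pairing0l mulr0; have [<-|] := eqVneq u.2 s.
  by case: ifP => // /GammaE.
by rewrite mulr0 if_same.
Qed.

Lemma pairing_vanish (f : l1 R G) (x : linf R G) :
  (forall t, f t != 0 -> x t = 0) -> pairing f x = 0.
Proof.
move=> fx; apply/eqP; rewrite -normr_le0 -(mul0r `|f|).
by apply: pairing_le => // t /fx ->; rewrite normr0.
Qed.

(** Unfolding the unit vector at g as dstar g + cstar g, biorthogonality gives
the indicator, and cstar g lives on lower ranks, where d_s vanishes by
induction. *)
Lemma d_triangular s g : (rk g <= rk s)%N -> d s g = (g == s)%:R.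
Proof.
elim/rank_ind: g => g IH gs.
have low t : (rk t < rk g)%N -> d s t = 0.
  move=> tg; rewrite IH //; last exact: leq_trans (ltnW tg) gs.
  by have [ts|//] := eqVneq t s; move: tg; rewrite ts ltnNge gs.
rewrite -pairing_unit unit_dstar pairingDl bio -[RHS]addr0; congr (_ + _).
rewrite /cstar; case: (elementP g) => [-> _|j b -> _ _ _ _ bs|].
- exact: pairing0l.
- rewrite pairingZl pairing_vanish ?mulr0 // => t /bs; exact: low.
move=> j xi b -> _ _ _ _ xg _ _ bs.
have b0 : pairing b (d s) = 0.
  by apply: pairing_vanish => t /bs /andP[_]; exact: low.
rewrite pairingDl pairing_unit low // add0r pairingZl pairingBl b0.
rewrite (@pairing_P b _ _ (rk g)); last by move=> t /bs /andP[].
by rewrite b0 if_same subr0 mulr0.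
Qed.

(** * Blocks *)

Let X : normedModType R := closed_span d.

Lemma d_mem s : d s \in is_closed_span d.
Proof. exact/asboolP/subset_closure/lin_span_gen. Qed.

Definition basis_vector s : X := ClosedSpan (d_mem s).

Definition coord (x : X) g : R := closed_span_val x g.

Lemma coordD x y g : coord (x + y) g = coord x g + coord y g.
Proof. exact: linf_funD. Qed.

Lemma coordZ a x g : coord (a *: x) g = a * coord x g.
Proof. exact: linf_funZ. Qed.

Lemma coordB x y g : coord (x - y) g = coord x g - coord y g.
Proof. by rewrite -scaleN1r coordD coordZ mulN1r. Qed.

Lemma coord0 g : coord 0 g = 0.
Proof. by rewrite -(subrr 0) coordB subrr. Qed.

Lemma coord_sum I (r : seq I) (F : I -> X) g :
  coord (\sum_(i <- r) F i) g = \sum_(i <- r) coord (F i) g.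
Proof.
by apply: (big_morph (coord^~ g)) => [x y|]; [exact: coordD|exact: coord0].
Qed.

Lemma coord_le x g : `|coord x g| <= `|x|.
Proof. exact: linf_norm_ub. Qed.

Lemma norm_le_coord x (A : R) : 0 <= A ->
  (forall g, `|coord x g| <= A) -> `|x| <= A.
Proof. exact: linf_norm_le. Qed.

(** Elements are given by lists of terms, possibly with repetitions, so that a
sum of blocks is a concatenation and uniqueness of coefficients never
matters. *)
Definition block p q : set X :=
  [set x | exists2 r : seq (R * G), all (fun u => p < rk u.2 <= q)%N r &
    x = \sum_(u <- r) u.1 *: basis_vector u.2].

Lemma block0 p q : block p q 0.
Proof. by exists [::]; rewrite ?big_nil. Qed.

Lemma blockD p q x y : block p q x -> block p q y -> block p q (x + y).
Proof.
move=> [r rpq ->] [s spq ->]; exists (r ++ s); last by rewrite big_cat.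
by rewrite all_cat rpq.
Qed.

Lemma blockZ p q a x : block p q x -> block p q (a *: x).
Proof.
move=> [r rpq ->]; exists [seq (a * u.1, u.2) | u <- r].
  by rewrite all_map.
by rewrite big_map scaler_sumr; apply: eq_bigr => u _; rewrite scalerA.
Qed.

Lemma blockB p q x y : block p q x -> block p q y -> block p q (x - y).
Proof. by move=> xb yb; rewrite -scaleN1r; apply/blockD/blockZ. Qed.

Lemma block_sum p q I (r : seq I) (Q : pred I) (F : I -> X) :
  (forall i, Q i -> block p q (F i)) -> block p q (\sum_(i <- r | Q i) F i).
Proof. move=> bF; apply: big_ind => //; [exact: block0|exact: blockD]. Qed.

Lemma block_basis s p q : (p < rk s <= q)%N -> block p q (basis_vector s).
Proof.
by move=> spq; exists [:: (1, s)]; rewrite ?big_seq1 ?scale1r //= spq.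
Qed.

Lemma block_widen p q p' q' x : (p' <= p)%N -> (q <= q')%N ->
  block p q x -> block p' q' x.
Proof.
move=> pp qq [r rpq ->]; exists r => //; apply: sub_all rpq => u /andP[pu uq].
by rewrite (leq_ltn_trans pp pu) (leq_trans uq qq).
Qed.

Lemma block_split r p q x : block p q x -> exists y z,
  [/\ block p (minn q r) y, block (maxn p r) q z & x = y + z].
Proof.
move=> [l lpq ->].
exists (\sum_(u <- l | (rk u.2 <= r)%N) u.1 *: basis_vector u.2).
exists (\sum_(u <- l | ~~ (rk u.2 <= r)%N) u.1 *: basis_vector u.2).
have lE u : u \in l -> (p < rk u.2 <= q)%N by exact: (allP lpq).
split; last by rewrite [LHS](bigID (fun u => (rk u.2 <= r)%N)).
- rewrite big_seq_cond; apply: block_sum => u /andP[/lE/andP[pu uq] ur].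
  by apply/blockZ/block_basis; rewrite pu leq_min uq.
- rewrite big_seq_cond; apply: block_sum => u /andP[/lE/andP[pu uq] ur].
  by apply/blockZ/block_basis; rewrite gtn_max pu uq ltnNge ur.
Qed.

Lemma block_pairing_eq f f' p q x :
  (forall s, (p < rk s <= q)%N -> pairing f (d s) = pairing f' (d s)) ->
  block p q x ->
  pairing f (closed_span_val x) = pairing f' (closed_span_val x).
Proof.
move=> ff' [r rpq ->]; elim: r rpq => [_|u r IH /= /andP[upq /IH {}IH]].
  by rewrite big_nil !pairing0r.
by rewrite big_cons !pairingDr !pairingZr IH ff'.
Qed.

Lemma coord_block_low p q x g : block p q x -> (rk g <= p)%N -> coord x g = 0.
Proof.
move=> xb gp; rewrite /coord -pairing_unit.
rewrite -[RHS](pairing0l (closed_span_val x)).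
apply: block_pairing_eq xb => s /andP[ps _].
have gs : (rk g < rk s)%N by exact: leq_ltn_trans ps.
rewrite pairing_unit pairing0l d_triangular; last exact: ltnW.
by have [gEs|//] := eqVneq g s; move: gs; rewrite gEs ltnn.
Qed.

(** Outside of the interval of ranks of a block, dstar g annihilates the block,
and the value at g is given by functionals of lower rank. *)
Lemma coord_block_cstar p q x g : block p q x -> ~~ (p < rk g <= q)%N ->
  coord x g = pairing (cstar code P g) (closed_span_val x).
Proof.
move=> xb gpq; rewrite /coord -pairing_unit.
apply: block_pairing_eq xb => s spq; rewrite unit_dstar pairingDl bio.
by have [gs|_] := eqVneq g s; rewrite ?add0r //; move: gpq; rewrite gs spq.
Qed.

(** By [pairing_P], the map 1 - P r is adjoint to keeping the part of a block
with ranks above r. *)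
Lemma pairing_tail f r p q k x y z : (forall t, f t != 0 -> (rk t < k)%N) ->
  block p r y -> block r q z -> x = y + z ->
  pairing (f - P r f) (closed_span_val x) = pairing f (closed_span_val z).
Proof.
move=> fk yb zb ->; rewrite pairingDr.
have -> : pairing (f - P r f) (closed_span_val y) = 0.
  rewrite -[RHS](pairing0l (closed_span_val y)).
  apply: block_pairing_eq yb => s /andP[_ sr].
  by rewrite pairing0l pairingBl (pairing_P _ _ fk) sr subrr.
rewrite add0r; apply: block_pairing_eq zb => s /andP[rs _].
by rewrite pairingBl (pairing_P _ _ fk) leqNgt rs subr0.
Qed.
Lemma block_empty p q x : (q <= p)%N -> block p q x -> x = 0.
Proof.
move=> qp [[_ ->|u r /= /andP[/andP[pu uq] _] _]]; first by rewrite big_nil.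
by have := leq_trans pu (leq_trans uq qp); rewrite ltnn.
Qed.

Lemma pairing_coord_le (b : l1 R G) x (A : R) : 0 <= A -> `|b| <= 1 ->
  (forall t, b t != 0 -> `|coord x t| <= A) ->
  `|pairing b (closed_span_val x)| <= A.
Proof.
move=> A0 b1 xA; apply: (le_trans (pairing_le A0 _)) => //.
by rewrite -[leRHS]mulr1 ler_wpM2l.
Qed.

Lemma coord_Delta1 p q x g : block p q x -> ~~ (p < rk g <= q)%N ->
  code g = Elt1 -> coord x g = 0.
Proof.
move=> xb gpq cg; rewrite (coord_block_cstar xb gpq) /cstar cg.
exact: pairing0l.
Qed.

Lemma coord_Type1 p q x g k w b : block p q x -> ~~ (p < rk g <= q)%N ->
  code g = Type1 k w b -> coord x g = w * pairing b (closed_span_val x).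
Proof.
move=> xb gpq cg; rewrite (coord_block_cstar xb gpq) /cstar cg.
exact: pairingZl.
Qed.

Lemma coord_Type2 p q x g k xi w b : block p q x -> ~~ (p < rk g <= q)%N ->
  code g = Type2 k xi w b -> (forall t, b t != 0 -> (rk t < rk g)%N) ->
  exists y z, [/\ block p (minn q (rk xi)) y, block (maxn p (rk xi)) q z,
    x = y + z &
    coord x g = coord x xi + w * pairing b (closed_span_val z)].
Proof.
move=> xb gpq cg bg; have [y [z [yb zb xyz]]] := block_split (rk xi) xb.
exists y, z; split=> //; rewrite (coord_block_cstar xb gpq) /cstar cg.
rewrite pairingDl pairing_unit pairingZl; congr (_ + _ * _).
apply: (@pairing_tail _ _ p q _ x y z bg) => //.
  by apply: block_widen yb; rewrite ?geq_minr.
by apply: block_widen zb; rewrite ?leq_maxr.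
Qed.

Let weightR_gt0 j : (0 < j)%N -> 0 < (m j)%:R :> R.
Proof. by move=> /(weight_ge4 mn) m4; rewrite ltr0n (leq_trans _ m4). Qed.

Let weightV_le j : (0 < j)%N -> (m j)%:R^-1 <= 4^-1 :> R.
Proof.
move=> j0; rewrite lef_pV2 ?posrE ?weightR_gt0 //.
by rewrite ler_nat (weight_ge4 mn).
Qed.

(** Elements determined by Gamma_q have at most twice their norm on Gamma_q.
The constant 2 reproduces itself in the induction: at an element of the second
type the value is that at xi, at most A when xi is in Gamma_q, plus at most 1/4
times a tail of x of norm at most 2 A + 2 A. *)
Lemma initial_bound q x (A : R) : 0 <= A -> block 0 q x ->
  (forall g, (rk g <= q)%N -> `|coord x g| <= A) ->
  forall g, `|coord x g| <= 2 * A.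
Proof.
move=> A0 xb xA g; elim/rank_ind: g q x xb xA => g IH q x xb xA.
have A2 : A <= 2 * A by rewrite mulr_natl mulr2n lerDl.
have [gq|qg] := leqP (rk g) q; first exact: le_trans (xA g gq) A2.
have g0q : ~~ (0 < rk g <= q)%N by rewrite [(_ <= q)%N]leqNgt qg andbF.
case: (elementP g) => [cg _|j b cg _ j0 _ b1 bs|].
- by rewrite (coord_Delta1 xb g0q cg) normr0 mulr_ge0.
- rewrite (coord_Type1 xb g0q cg) normrM ger0_norm ?invr_ge0 ?ler0n //.
  rewrite -[leRHS]mul1r ler_pM ?invr_ge0 ?ler0n //.
    by rewrite (le_trans (weightV_le j0)) // invf_le1 ?ler1n // ltr0n.
  apply: pairing_coord_le b1 _ => [|t /bs tg]; first by rewrite mulr_ge0.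
  exact: IH xb xA.
move=> j xi b cg _ _ j0 _ xg _ b1 bs.
have [|y [z [yb zb xyz ->]]] := coord_Type2 xb g0q cg.
  by move=> t /bs /andP[].
have [qxi|xiq] := leqP q (rk xi).
  rewrite (block_empty _ zb) ?max0n // pairing0r mulr0 addr0.
  exact: IH xb xA.
have yA t : (rk t <= minn q (rk xi))%N -> `|coord y t| <= A.
  rewrite leq_min => /andP[tq txi]; rewrite -[coord y t]addr0.
  by rewrite -(coord_block_low zb (g := t)) ?max0n // -coordD -xyz xA.
have zA : `|pairing b (closed_span_val z)| <= 4 * A.
  apply: pairing_coord_le b1 _ => [|t /bs /andP[_ tg]].
    by rewrite mulr_ge0.
  have -> : z = x - y by rewrite xyz addrC addKr.
  rewrite coordB (le_trans (ler_normB _ _)) //.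
  have -> : 4 * A = 2 * A + 2 * A by rewrite -mulrDl -natrD.
  by rewrite lerD // ?(IH _ tg _ _ xb) // (IH _ tg _ _ yb).
rewrite (le_trans (ler_normD _ _)) // mulr_natl mulr2n lerD ?xA ?(ltnW xiq) //.
rewrite normrM ger0_norm ?invr_ge0 ?ler0n //.
have -> : A = 4^-1 * (4 * A) by rewrite mulKf // pnatr_eq0.
by rewrite ler_pM ?invr_ge0 ?ler0n // weightV_le.
Qed.

(** By [d_triangular], adding multiples of the d_s with s of rank q.+1 corrects
the values on that level without changing those on Gamma_q. *)
Lemma block_extension p q (u : G -> R) : (p <= q)%N ->
  (forall g, (rk g <= p)%N -> u g = 0) ->
  exists2 x, block p q x & forall g, (rk g <= q)%N -> coord x g = u g.
Proof.
move=> pq u0; elim: q pq => [|q IH].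
  rewrite leqn0 => /eqP p0; exists 0; first exact: block0.
  by move=> g g0; rewrite coord0 u0 // p0.
rewrite leq_eqVlt ltnS => /predU1P[pq|pq].
  by exists 0 => [|g gq]; [exact: block0|rewrite coord0 u0 // pq].
have [x xb xu] := IH pq.
have finD : finite_set (Delta code q.+1) by exact: bd_Delta_finite bdG _.
pose c s := u s - coord x s.
pose y := \sum_(s <- fset_set (Delta code q.+1)) c s *: basis_vector s.
have yb : block q q.+1 y.
  rewrite /y big_seq; apply: block_sum => s; rewrite in_fset_set // inE.
  by move=> sq; apply/blockZ/block_basis; rewrite sq leqnn.
exists (x + y); first exact: blockD (block_widen _ _ xb) (block_widen _ _ yb).
move=> g; rewrite coordD leq_eqVlt ltnS => /predU1P[gq|gq]; last first.
  by rewrite (coord_block_low yb gq) addr0 xu.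
have gD : g \in fset_set (Delta code q.+1) by rewrite in_fset_set // inE.
rewrite coord_sum (bigD1_seq g) //= big_seq_cond big1 ?addr0.
  by rewrite coordZ /coord d_triangular // eqxx mulr1 addrC subrK.
move=> s /andP[]; rewrite in_fset_set // inE => sq sg.
rewrite coordZ /coord d_triangular ?gq ?sq // eq_sym (negbTE sg).
exact: mulr0.
Qed.
Lemma tail_bound r q x y z : block 0 r y -> block r q z -> x = y + z ->
  `|z| <= 3 * `|x|.
Proof.
move=> yb zb xyz; have yx : `|y| <= 2 * `|x|.
  apply: norm_le_coord; first by rewrite mulr_ge0.
  apply: initial_bound yb _ => // g gr.
  by rewrite -[coord y g]addr0 -(coord_block_low zb gr) -coordD -xyz coord_le.
have -> : z = x - y by rewrite xyz addrC addKr.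
rewrite (le_trans (ler_normB _ _)) //.
by rewrite -[3]/(1 + 2)%:R natrD mulrDl mul1r lerD2l.
Qed.

(** * Values of blocks at elements of a given weight *)

Lemma weightR_inj i j : (0 < i)%N -> (0 < j)%N ->
  Some (m i)%:R = Some (m j)%:R :> option R -> i = j.
Proof.
move=> i0 j0 [] /eqP; rewrite eqr_nat => /eqP.
exact (weight_inj mn i0 j0).
Qed.

Lemma age_le g j : (0 < j)%N -> weight code g = Some (m j)%:R ->
  (age g <= n j)%N.
Proof.
move=> j0; case: (elementP g) => [_ ->//|i b cg -> i0 _ _ _|] .
  by rewrite (bd_age1 bdG cg) (ws_n_gt0 mn).
move=> i xi b cg -> _ i0 _ _ ai _ _ /(weightR_inj i0 j0) <-.
by rewrite (bd_age2 bdG cg).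
Qed.

(** The list r consists of the rank of g, of the rank of the element xi from
which g is built, and so on down to an element of the first type; the age
counts them.  A block on (p, q] containing none of these ranks sits between two
successive ones, so that only the functional b of a single step sees it, with
the factor 1/m_j.  That all these ranks are at least j is the restriction on
weights in the upper assumption; it makes the estimate apply, at elements of
weight m_j, to every block that ends before j. *)
Lemma analysis_ranks g j : (0 < j)%N -> weight code g = Some (m j)%:R ->
  exists r : seq nat,
  [/\ (size r <= n j)%N, forall k, k \in r -> (j <= k)%N &
    forall p q x, block p q x -> (forall k, k \in r -> ~~ (p < k <= q)%N) ->
      `|coord x g| <= `|x| / (m j)%:R].
Proof.
move=> j0 wg; suff [r [rage rg rj rx]] : exists r : seq nat,
  [/\ (size r <= age g)%N, rk g \in r, forall k, k \in r -> (j <= k)%N &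
    forall p q x, block p q x -> (forall k, k \in r -> ~~ (p < k <= q)%N) ->
      `|coord x g| <= `|x| / (m j)%:R].
  by exists r; split=> //; exact: leq_trans rage (age_le j0 wg).
elim/rank_ind: g wg => g IH.
case: (elementP g) => [_ ->//|i b cg -> i0 ig b1 bs|].
  move=> /(weightR_inj i0 j0) ij; rewrite {}ij in cg ig; exists [:: rk g].
  split; rewrite ?mem_head ?(bd_age1 bdG cg) //.
    by move=> k; rewrite inE => /eqP ->.
  move=> p q x xb /(_ _ (mem_head _ _)) gpq.
  rewrite (coord_Type1 xb gpq cg) normrM mulrC.
  rewrite (ger0_norm (x := _^-1)) ?invr_ge0 ?ler0n //.
  rewrite ler_pM2r ?invr_gt0 ?weightR_gt0 //.
  by apply: pairing_coord_le => // t _; exact: coord_le.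
move=> i xi b cg -> wxi i0 ixi xg ai b1 bs /(weightR_inj i0 j0) ij.
rewrite {}ij in cg wxi ixi ai.
have [r [rage rxi rj rx]] := IH xi xg wxi.
exists (rk g :: r); split; rewrite ?mem_head ?(bd_age2 bdG cg) //.
  move=> k; rewrite inE => /predU1P[->|/rj//].
  exact: leq_trans ixi (ltnW xg).
move=> p q x xb gr.
have gpq := gr _ (mem_head _ _).
have {}gr k : k \in r -> ~~ (p < k <= q)%N.
  by move=> kr; rewrite gr // inE kr orbT.
have [|y [z [yb zb xyz ->]]] := coord_Type2 xb gpq cg.
  by move=> t /bs /andP[].
have [xip|pxi] := leqP (rk xi) p.
  rewrite (coord_block_low xb xip) add0r normrM mulrC.
  rewrite (ger0_norm (x := _^-1)) ?invr_ge0 ?ler0n //.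
  rewrite ler_pM2r ?invr_gt0 ?weightR_gt0 //.
  apply: pairing_coord_le => // t _; rewrite xyz (block_empty _ yb).
    by rewrite add0r coord_le.
  by rewrite geq_min xip orbT.
have qxi : (q <= rk xi)%N.
  by have := gr _ rxi; rewrite pxi /= -ltnNge => /ltnW.
rewrite (block_empty _ zb) ?leq_max ?qxi ?orbT // pairing0r mulr0 addr0.
exact: rx xb gr.
Qed.

(** While g is unfolded, the last element of rank at most q met has the weight
of g, hence contributes nothing; the only other contribution is the value of
one functional b at a tail of x, with the factor 1/m_j. *)
Lemma coord_foreign_weight g j p q x : (0 < j)%N ->
  weight code g = Some (m j)%:R -> block p q x ->
  (forall t, (rk t <= q)%N -> weight code t = Some (m j)%:R ->
    coord x t = 0) ->
  `|coord x g| <= 3 * `|x| / (m j)%:R.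
Proof.
move=> j0 wg xb x0; elim/rank_ind: g wg => g IH.
have rhs0 : 0 <= 3 * `|x| / (m j)%:R by rewrite !mulr_ge0 ?invr_ge0 ?ler0n.
have [gq wg|qg] := leqP (rk g) q; first by rewrite x0 // normr0.
have gpq : ~~ (p < rk g <= q)%N by rewrite [(_ <= q)%N]leqNgt qg andbF.
case: (elementP g) => [_ ->//|i b cg -> i0 ig b1 bs|].
  move=> /(weightR_inj i0 j0) ij; rewrite {}ij in cg ig.
  rewrite (coord_Type1 xb gpq cg) normrM mulrC.
  rewrite (ger0_norm (x := _^-1)) ?invr_ge0 ?ler0n //.
  rewrite ler_pM2r ?invr_gt0 ?weightR_gt0 //.
  apply: pairing_coord_le => // t _.
  by rewrite (le_trans (coord_le _ _)) // ler_peMl // ler1n.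
move=> i xi b cg -> wxi i0 ixi xg ai b1 bs /(weightR_inj i0 j0) ij.
rewrite {}ij in cg wxi ixi ai.
have [|y [z [yb zb xyz ->]]] := coord_Type2 xb gpq cg.
  by move=> t /bs /andP[].
have [qxi|xiq] := leqP q (rk xi).
  rewrite (block_empty _ zb) ?leq_max ?qxi ?orbT // pairing0r mulr0 addr0.
  exact: IH.
rewrite x0 ?(ltnW xiq) // add0r normrM mulrC.
rewrite (ger0_norm (x := _^-1)) ?invr_ge0 ?ler0n //.
rewrite ler_pM2r ?invr_gt0 ?weightR_gt0 //.
apply: pairing_coord_le => // t _.
rewrite (le_trans (coord_le _ _)) //.
apply: (@tail_bound (rk xi) q x y z) => //.
  by apply: block_widen yb; rewrite ?geq_minr.
by apply: block_widen zb; rewrite ?leq_maxr.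
Qed.

(** * Sparse sequences of blocks *)

(** The interval of the block x k is (q k, q k.+1], and the exceptional index k0
depends on the element g. *)
Definition sparse (D : R) (q : nat -> nat) (x : nat -> X) : Prop :=
  [/\ (0 < q 0)%N, (forall k, q k <= q k.+1)%N,
      forall k, block (q k) (q k.+1) (x k) &
      forall g j, (0 < j)%N -> weight code g = Some (m j)%:R ->
        exists k0, forall k, k != k0 -> `|coord (x k) g| <= D / (m j)%:R].

Definition average M (x : nat -> X) l : X :=
  M%:R^-1 *: \sum_(k < M) x (l * M + k)%N.

Lemma coord_average M x l g (B : R) : (0 < M)%N ->
  \sum_(k < M) `|coord (x (l * M + k)%N) g| <= M%:R * B ->
  `|coord (average M x l) g| <= B.
Proof.
move=> M0 xB; rewrite coordZ coord_sum normrM normfV normr_nat mulrC.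
rewrite ler_pdivrMr ?ltr0n // mulrC.
exact: le_trans (ler_norm_sum _ _ _) xB.
Qed.

Lemma sparse_mono D q x i j :
  sparse D q x -> (i <= j)%N -> (q i <= q j)%N.
Proof.
move=> [_ qS _ _] ij; rewrite -(subnK ij); elim: (j - i)%N => // k IH.
by rewrite addSn; exact: leq_trans IH (qS _).
Qed.

(** The exceptional index k0 lies in only one of the groups of M consecutive
indices, so the constant D does not deteriorate. *)
Lemma average_sparse D q x M : (0 < M)%N -> sparse D q x ->
  sparse D (fun l => q (l * M)%N) (average M x).
Proof.
move=> M0 xs; have qm := sparse_mono xs; have [q0 qS xb xD] := xs; split=> //.
- by move=> k; apply: qm; rewrite leq_mul2r leqnSn orbT.
- move=> l; apply/blockZ/block_sum => k _.
  apply: block_widen (xb _); apply: qm; first exact: leq_addr.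
  by rewrite mulSn [(M + _)%N]addnC -addnS leq_add2l ltn_ord.
move=> g j j0 wg; have [k0 xk0] := xD g j j0 wg.
exists (k0 %/ M)%N => l lk; apply: coord_average => //.
rewrite mulr_natl -[M in leRHS]card_ord -sumr_const; apply: ler_sum => k _.
apply: xk0; apply: contraNneq lk => <-.
by rewrite divnMDl // divn_small // addn0.
Qed.

(** Fix j1 such that D/m_j <= A/4 for j >= j1.  At an element of weight m_j, all
but one of the values are at most A/4 if j >= j1, and all but n_j of them
are if j < j1.  Since every value is at most A, it suffices to take M at least
four times the number of exceptions. *)
Lemma average_halves D q x (A : R) : 0 <= D -> 0 < A -> sparse D q x ->
  (forall k, `|x k| <= A) ->
  exists2 M, (0 < M)%N & forall l, `|average M x l| <= A / 2.
Proof.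
move=> D0 A0 xs xA; have qm := sparse_mono xs; have [q0 qS xb xD] := xs.
pose j1 := Num.bound (4 * D / A).
pose B := (\max_(j < j1) n j)%N.
exists (4 * B.+1)%N => // l; set M := (4 * B.+1)%N.
apply: norm_le_coord => [|g]; first by rewrite divr_ge0 // ltW.
apply: coord_average => //.
have sum_le (e : nat -> nat) : (\sum_(k < M) e k <= B.+1)%N ->
    (forall k, `|coord (x (l * M + k)%N) g| <= A / 4 + A * (e k)%:R) ->
    \sum_(k < M) `|coord (x (l * M + k)%N) g| <= M%:R * (A / 2).
  move=> eB xe; apply: (@le_trans _ _ (\sum_(k < M) (A / 4 + A * (e k)%:R))).
    by apply: ler_sum => k _.
  rewrite big_split /= sumr_const card_ord -mulr_sumr -natr_sum -mulr_natl.
  have : A * (\sum_(k < M) e k)%:R <= A * B.+1%:R.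
    by rewrite ler_pM2l // ler_nat.
  rewrite /M natrM; lra.
have large j : (0 < j)%N -> weight code g = Some (m j)%:R ->
    \sum_(k < M) `|coord (x (l * M + k)%N) g| <= M%:R * (A / 2).
  move=> j0 wg; have [jj1|j1j] := ltnP j j1.
    have [r [rn _ rx]] := analysis_ranks j0 wg.
    pose in_range k t := (q (l * M + k) < t <= q (l * M + k.+1))%N.
    pose e k := count (in_range k) r.
    apply: (sum_le e) => [|k].
      have qS' k : (q (l * M + k) <= q (l * M + k.+1))%N by rewrite addnS.
      apply: (leq_trans (sum_count_jumps qS' r M)).
      apply: (leq_trans rn); apply: leqW.
      exact: (leq_bigmax (Ordinal jj1)).
    have [ek|] := boolP (has (in_range k) r).
      rewrite (le_trans (coord_le _ _)) // (le_trans (xA _)) //.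
      apply: ler_wpDl; first by rewrite divr_ge0 // ltW.
      by rewrite ler_peMr ?(ltW A0) // ler1n -has_count.
    move=> /hasPn ek.
    apply: (le_trans (rx _ _ _ (xb (l * M + k)%N) _)).
      by move=> t /ek; rewrite /in_range addnS.
    rewrite ler_wpDr ?mulr_ge0 ?(ltW A0) //.
    by rewrite ler_pM ?invr_ge0 ?ler0n // weightV_le.
  have Dj : D / (m j)%:R <= A / 4.
    rewrite ler_pdivrMr ?weightR_gt0 //.
    have := archi_boundP (divr_ge0 (mulr_ge0 (ler0n _ 4) D0) (ltW A0)).
    have : (j1%:R : R) <= (m j)%:R.
      by rewrite ler_nat (leq_trans j1j) // (weight_ge_index mn).
    rewrite -/j1 => jm /lt_le_trans /(_ jm).
    rewrite ltr_pdivrMr // => /ltW; lra.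
  have [k0 xk0] := xD g j j0 wg.
  (* k |-> l * M + k passes k0.+1 only in the step that starts at k0. *)
  apply: (sum_le (fun k => (l * M + k < k0.+1 <= l * M + k.+1)%N)) => [|k].
    rewrite (leq_trans (sum_jumps (q := fun k => l * M + k)%N _ k0.+1 M)) //.
      by move=> i; rewrite addnS.
    exact: leq_trans (leq_b1 _) _.
  have [<-|/xk0 xk] := eqVneq (l * M + k)%N k0.
    rewrite addnS ltnSn mulr1 (le_trans (coord_le _ _)) //.
    by rewrite (le_trans (xA _)) // lerDr divr_ge0 // ltW.
  apply: (le_trans xk); apply: (le_trans Dj).
  by rewrite lerDl mulr_ge0 // ltW.
case: (elementP g) => [cg _|j b _ wg j0 _ _ _|j xi b _ wg _ j0 _ _ _ _ _].
- rewrite big1 ?mulr_ge0 ?invr_ge0 // 1?ltW // => k _.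
  rewrite (coord_block_low (xb _)) ?normr0 // /rank cg.
  by rewrite (leq_trans q0) // qm.
- exact: large wg.
- exact: large wg.
Qed.

Section functional.
Variable phi : dual X.

Lemma dual_scalar : scalar phi.
Proof. by case: phi => f /= /asboolP[]. Qed.

Lemma dualD x y : phi (x + y) = phi x + phi y.
Proof. by rewrite -[x]scale1r dual_scalar mul1r scale1r. Qed.

Lemma dual0 : phi 0 = 0.
Proof. by apply: (addrI (phi 0)); rewrite -dualD !addr0. Qed.

Lemma dualZ a x : phi (a *: x) = a * phi x.
Proof. by rewrite -[a *: x]addr0 dual_scalar dual0 addr0. Qed.

Lemma dualB x y : phi (x - y) = phi x - phi y.
Proof. by rewrite -scaleN1r dualD dualZ mulN1r. Qed.

Lemma dual_sum I (r : seq I) (F : I -> X) :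
  phi (\sum_(i <- r) F i) = \sum_(i <- r) phi (F i).
Proof. by apply: (big_morph phi) => [x y|]; [exact: dualD|exact: dual0]. Qed.

(** Averaging preserves the lower bound on phi and halves the norms, so after t
rounds eps is at most a constant times 2^-t. *)
Lemma sparse_not_bounded_below D q x (C eps : R) :
  0 <= D -> 0 < C -> 0 < eps ->
  sparse D q x -> (forall k, `|x k| <= C) -> ~ forall k, eps <= phi (x k).
Proof.
move=> D0 C0 eps0 xs xC xphi.
have [K K0 phiK] : exists2 K : R, 0 <= K & forall x, `|phi x| <= K * `|x|.
  by exists (dual_norm phi); [exact: dual_norm_ge0|exact: dual_norm_ub].
have halved t : exists q x, [/\ sparse D q x,
    forall k, `|x k| <= C / 2 ^+ t & forall k, eps <= phi (x k)].
  elim: t => [|t [q' [x' [xs' xC' xphi']]]].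
    by exists q, x; split=> // k; rewrite expr0 divr1.
  have Ct : 0 < C / 2 ^+ t by rewrite divr_gt0 ?exprn_gt0.
  have [M M0 xM] := average_halves D0 Ct xs' xC'.
  exists (fun l => q' (l * M)%N), (average M x'); split.
  - exact: average_sparse.
  - by move=> k; rewrite (le_trans (xM k)) // exprSr invfM mulrA.
  - move=> l; rewrite dualZ dual_sum mulrC ler_pdivlMr ?ltr0n //.
    by rewrite mulr_natr -[M in leLHS]card_ord -sumr_const; apply: ler_sum.
pose t := Num.bound (K * C / eps).
have [q' [x' [_ /(_ 0) x0C /(_ 0) x0phi]]] := halved t.
have : eps <= K * (C / 2 ^+ t).
  rewrite (le_trans x0phi) // (le_trans (ler_norm _)) // (le_trans (phiK _)) //.
  by rewrite ler_wpM2l.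
rewrite mulrA ler_pdivlMr ?exprn_gt0 // mulrC -ler_pdivlMr // leNgt => /negP.
apply.
have := archi_boundP (divr_ge0 (mulr_ge0 K0 (ltW C0)) (ltW eps0)).
move=> /lt_trans; apply; rewrite -/t -natrX ltr_nat; exact: ltn_expl.
Qed.

(** * Functionals are small on late blocks *)

(** The condition only concerns Gamma_q, hence the weights used to define a
block on (p, q]; at elements of larger rank the block takes values at all
weights. *)
Definition avoids q x (J : set nat) : Prop := forall g j, (rk g <= q)%N ->
  (0 < j)%N -> J j -> weight code g = Some (m j)%:R -> coord x g = 0.

Lemma coord_avoided_weight J g j p q x : block p q x -> avoids q x J ->
  (0 < j)%N -> J j -> weight code g = Some (m j)%:R ->
  `|coord x g| <= 3 * `|x| / (m j)%:R.
Proof.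
move=> xb xJ j0 Jj wg; apply: (coord_foreign_weight j0 wg xb) => t tq.
exact: xJ.
Qed.

(** Dependent choice, each block starting at the rank where the previous one
ends. *)
Lemma block_sequence (B : nat -> nat -> X -> Prop) :
  (forall p, exists q x, (p <= q)%N /\ B p q x) ->
  exists (q : nat -> nat) (x : nat -> X),
    [/\ (0 < q 0)%N, forall k, (q k <= q k.+1)%N &
        forall k, B (q k) (q k.+1) (x k)].
Proof.
move=> Bex.
have /choice[f fB] : forall p, exists u : nat * X, (p <= u.1)%N /\ B p u.1 u.2.
  by move=> p; have [q [x qx]] := Bex p; exists (q, x).
exists (fun k => iter k (fun p => (f p).1) 1%N).
exists (fun k => (f (iter k (fun p => (f p).1) 1%N)).2).
by split=> // k; rewrite iterS; case: (fB (iter k (fun p => (f p).1) 1%N)).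
Qed.

(** A bad sequence would be sparse: at weights beyond m_K by
[coord_foreign_weight], and at the finitely many others because D can be taken
larger than all of them, so that D/m_j exceeds the norm of the blocks. *)
Lemma small_on_bounded_weights K (eps : R) : 0 < eps ->
  exists p, forall q x, block p q x -> avoids q x [set j | (K < j)%N] ->
    `|x| <= 1 -> `|phi x| <= eps.
Proof.
move=> eps0; apply: contrapT => /forallNP bad.
pose B p q x := [/\ block p q x, avoids q x [set j | (K < j)%N],
  `|x| <= 1 & eps <= phi x].
have [p|q [x [q0 qS xB]]] := @block_sequence B.
  have {bad} /existsNP[q] := bad p.
  move=> /existsNP[x].
  move=> /not_implyP[xb /not_implyP[xK /not_implyP[x1 /negP]]].
  rewrite -ltNge => phix; exists q.
  have pq : (p <= q)%N.
    rewrite leqNgt; apply/negP => qp.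
    by move: phix; rewrite (block_empty (ltnW qp) xb) dual0 normr0 ltNge ltW.
  have [phi0|phi0] := leP 0 (phi x).
    by exists x; do !split=> //; rewrite -(ger0_norm phi0) ltW.
  exists (- 1 *: x); split=> //; split=> //.
  - exact: blockZ.
  - by move=> g j gq j0 Kj wg; rewrite coordZ (xK g j) ?mulr0.
  - by rewrite scaleN1r normrN.
  - by rewrite dualZ mulN1r -(ltr0_norm phi0) ltW.
have D0 : 0 <= 3 * (m K.+1)%:R :> R by rewrite mulr_ge0.
apply: (@sparse_not_bounded_below _ q x 1 eps D0 ltr01 eps0); last 2 first.
- by move=> k; case: (xB k).
- by move=> k; case: (xB k).
split=> // [k|g j j0 wg]; first by case: (xB k).
exists 0%N => k _; have [xb xK x1 _] := xB k.
have mK1 : 1 <= (m K.+1)%:R :> R.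
  by rewrite ler1n (leq_trans _ (weight_ge4 mn _)).
have [Kj|jK] := ltnP K j.
  apply: (le_trans (coord_avoided_weight xb xK j0 Kj wg)).
  by rewrite ler_pM2r ?invr_gt0 ?weightR_gt0 // ler_pM2l // (le_trans x1).
rewrite (le_trans (coord_le _ _)) // (le_trans x1) //.
rewrite ler_pdivlMr ?weightR_gt0 // mul1r.
apply: (@le_trans _ _ (m K.+1)%:R).
  by rewrite ler_nat ltnW // (weight_lt mn).
by rewrite ler_peMl // ler1n.
Qed.

(** A sequence of bad blocks is built in such a way that phi is small on the
part of the next block with local weights up to m_p, where p is the rank at
which the blocks chosen so far end.  The rest w avoids these weights, and the
sequence of the rests is sparse: at an element of weight m_j, the blocks
starting at a rank at least j are handled by [coord_foreign_weight], those
ending before j by [analysis_ranks], and at most one block contains j in its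
interval of ranks. *)
Lemma shrinking (eps : R) : 0 < eps ->
  exists p, forall q x, block p q x -> `|phi x| <= eps * `|x|.
Proof.
move=> eps0; apply: contrapT => /forallNP bad.
have {}bad p : exists q x, [/\ block p q x, `|x| <= 1 & eps < phi x].
  have {bad} /existsNP[q] := bad p.
  move=> /existsNP[x].
  move=> /not_implyP[xb /negP]; rewrite -ltNge => phix; exists q.
  have x0 : 0 < `|x|.
    rewrite normr_gt0; apply/eqP => x0; move: phix.
    by rewrite x0 dual0 !normr0 mulr0 ltxx.
  exists ((Num.sg (phi x) / `|x|) *: x); split; first exact: blockZ.
    rewrite normrZ normrM normfV normr_id divfK ?gt_eqF //.
    by rewrite normr_sg; case: eqP.
  rewrite dualZ mulrAC ltr_pdivlMr //.
  by rewrite -normrEsg.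
pose B p (q : nat) w := [/\ block p q w, avoids q w [set j | (j <= p)%N],
  `|w| <= 3 & eps / 2 <= phi w].
have [p|q [w [q0 qS wB]]] := @block_sequence B.
  have eps4 : 0 < eps / 4 by rewrite divr_gt0.
  have [p1 small] := small_on_bounded_weights p eps4.
  have [q [x [xb x1 xphi]]] := bad (maxn p p1).
  have ppq : (maxn p p1 <= q)%N.
    rewrite leqNgt; apply/negP => qp.
    by move: xphi; rewrite (block_empty (ltnW qp) xb) dual0 ltNge ltW.
  pose light g := `[< exists2 j, (0 < j <= p)%N &
    weight code g = Some (m j)%:R >].
  pose u g := if light g then coord x g else 0.
  have [g gp|v vb vu] := @block_extension (maxn p p1) q u ppq.
    by rewrite /u (coord_block_low xb gp) if_same.
  have v2 : `|v| <= 2.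
    apply: norm_le_coord => // g0; rewrite -[2]mulr1.
    move: g0; apply: (@initial_bound q) => // [|g gq].
      exact: block_widen vb.
    rewrite vu // /u; case: ifP => _; last by rewrite normr0.
    exact: le_trans (coord_le _ _) x1.
  have vphi : `|phi v| <= eps / 2.
    have -> : v = 2 *: (2^-1 *: v) by rewrite scalerA divff ?scale1r.
    rewrite dualZ normrM ger0_norm //.
    suff : `|phi (2^-1 *: v)| <= eps / 4 by lra.
    apply: (small q).
    - by apply/blockZ; apply: block_widen vb; rewrite ?leq_maxr.
    - move=> g j gq j0 /= pj wg; rewrite coordZ vu // /u ifF ?mulr0 //.
      apply/negP => /asboolP[i /andP[i0 ip]]; rewrite wg.
      by move=> /(weightR_inj j0 i0) ji; rewrite -ji leqNgt pj in ip.
    - by rewrite normrZ ger0_norm ?invr_ge0 // mulrC ler_pdivrMr // mul1r.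
  exists q, (x - v); split; first by rewrite (leq_trans _ ppq) // leq_maxl.
  split.
  - apply: blockB; [apply: block_widen xb|apply: block_widen vb];
      by rewrite ?leq_maxl.
  - move=> g j gq j0 /= jp wg; rewrite coordB vu // /u ifT ?subrr //.
    by apply/asboolP; exists j; rewrite ?j0.
  - rewrite (le_trans (ler_normB _ _)) //; lra.
  - rewrite dualB; move: vphi; rewrite ler_norml => /andP[_ vphi]; lra.
have wb k : block (q k) (q k.+1) (w k) by case: (wB k).
have D0 : 0 <= 9 :> R by [].
have C0 : 0 < 3 :> R by [].
have e0 : 0 < eps / 2 by rewrite divr_gt0.
suff ws : sparse 9 q w.
  by apply: (sparse_not_bounded_below D0 C0 e0 ws) => k; case: (wB k).
split=> // g j j0 wg.
have far k : ~~ (q k < j <= q k.+1)%N -> `|coord (w k) g| <= 9 / (m j)%:R.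
  have [_ wJ w3 _] := wB k; have [jq _|qj] := leqP j (q k).
    apply: (le_trans (coord_avoided_weight (wb k) wJ j0 jq wg)).
    rewrite ler_pM2r ?invr_gt0 ?weightR_gt0 //; lra.
  rewrite -ltnNge => qSj.
  have [r [_ rj rx]] := analysis_ranks j0 wg.
  apply: (le_trans (rx _ _ _ (wb k) _)).
    move=> i /rj ji; rewrite negb_and -!leqNgt -ltnNge.
    by rewrite (leq_trans qSj ji) orbT.
  rewrite ler_pM2r ?invr_gt0 ?weightR_gt0 //; lra.
have [[k0 /andP[qj jq]]|none] := pselect (exists k0, q k0 < j <= q k0.+1)%N.
  exists k0 => k kk0; apply: far; apply: contra kk0 => /andP[qkj jqk].
  have mono i l : (i < l)%N -> (q i.+1 <= q l)%N.
    move=> il; elim: l il => // l IH; rewrite ltnS leq_eqVlt.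
    by move=> /predU1P[->//|/IH il]; exact: leq_trans il (qS _).
  case: (ltngtP k k0) => // /mono qq.
    by have := leq_ltn_trans (leq_trans jqk qq) qj; rewrite ltnn.
  by have := leq_ltn_trans (leq_trans jq qq) qkj; rewrite ltnn.
by exists 0%N => k _; apply: far; apply/negP => qk; apply: none; exists k.
Qed.
End functional.

(** * The evaluation map *)

Lemma pairing_dual_mem (f : l1 R G) :
  (fun x : X => pairing f (closed_span_val x) : R^o) \in @is_dual R X.
Proof.
apply/asboolP; split=> [a x y|]; first exact: pairing_linr.
apply: (@lipschitz_continuous R X R^o _ `|f|) => x y.
change (`|pairing f (closed_span_val x) - pairing f (closed_span_val y)| <=
  `|f| * `|x - y|).
by rewrite -pairingBr mulrC; exact: pairing_norm.
Qed.

Definition evaluation (f : l1 R G) : dual X := Dual (pairing_dual_mem f).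

Lemma evaluation_linear : linear evaluation.
Proof. by move=> a f f'; apply/val_inj/funext => x; exact: pairing_linl. Qed.

Lemma evaluationB f f' :
  evaluation (f - f') = evaluation f - evaluation f'.
Proof. by rewrite -scaleN1r addrC evaluation_linear scaleN1r addrC. Qed.

Lemma evaluation_norm f : `|evaluation f| <= `|f|.
Proof.
apply: dual_norm_le => x x1; apply: (le_trans (pairing_norm _ _)).
by rewrite -[leRHS]mul1r ler_wpM2r.
Qed.

(** Test f against the extension of its signs on a Gamma_q carrying most of its
norm. *)
Lemma norm_le_evaluation f : `|f| <= 2 * `|evaluation f|.
Proof.
apply/ler_addgt0Pr => e e0.
have e3 : 0 < e / 3 by rewrite divr_gt0.
have [A fA ltA] := partial_norm_adherent f e3.
have [q Aq] : exists q, A `<=` Gamma code q.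
  exists (\max_(t <- fset_set A) rk t)%N => t At; apply/GammaE.
  by apply: (leq_bigmax_seq t) => //; rewrite in_fset_set // inE.
have [f1 [f2 [ff ffn f1q f10]]] := l1_restrict (Gamma code q) f.
have f2e : `|f2| <= e / 3.
  have : partial_norm f A <= `|f1|.
    apply: le_trans (partial_norm_le f1 fA).
    rewrite /partial_norm big_seq [leRHS]big_seq; apply: ler_sum => t.
    by rewrite in_fset_set // inE => /Aq At; rewrite f1q.
  by move: ltA; rewrite ffn; lra.
have [g g0|x xb xf] := @block_extension 0 q (fun t => Num.sg (f t)) (leq0n q).
  by have := bd_rank_gt0 bdG g; rewrite ltnNge g0.
have x2 : `|x| <= 2.
  apply: norm_le_coord => // g; rewrite -[2]mulr1; move: g.
  apply: (initial_bound _ xb) => // g gq.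
  by rewrite xf // normr_sg; case: eqP.
have f1x : pairing f1 (closed_span_val x) = `|f1|.
  have f1xE t : l1_mul f1 (closed_span_val x) t = `|f1 t|.
    change (f1 t * coord x t = `|f1 t|).
    have [tq|tq] := pselect (Gamma code q t).
      have xt : coord x t = Num.sg (f t) by apply: xf; exact/GammaE.
      by rewrite f1q // xt mulrC [RHS]normrEsg.
    by rewrite f10 // mul0r normr0.
  rewrite pairingE -[l1_mul _ _]subr0 signed_sumB //; last first.
    by move=> t; rewrite f1xE.
  rewrite normr0 subr0; apply: EFin_inj; rewrite -!l1_sumE.
  by apply: eq_esum => t _; rewrite f1xE !abse_EFin normr_id.
have f2x : `|pairing f2 (closed_span_val x)| <= 2 * `|f2|.
  by apply: le_trans (pairing_norm _ _) _; rewrite ler_wpM2r.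
have fx : `|evaluation f x| <= 2 * `|evaluation f|.
  rewrite mulrC; apply: le_trans (dual_norm_ub _ _) _.
  by rewrite ler_wpM2l // dual_norm_ge0.
have : pairing f (closed_span_val x) <= 2 * `|evaluation f|.
  exact: le_trans (ler_norm _) fx.
rewrite {1}ff pairingDl f1x; move: f2x; rewrite ler_norml => /andP[f2x _].
by rewrite ffn; lra.
Qed.

Lemma block_dense (x : X) (e : R) : 0 < e ->
  exists q y, block 0 q y /\ `|x - y| < e.
Proof.
move=> e0; have /asboolP cx : closed_span_val x \in is_closed_span d by case: x.
have [w [r wr] xw] := closure_norm cx e0.
exists (\max_(u <- r) rk u.2)%N, (\sum_(u <- r) u.1 *: basis_vector u.2); split.
  exists r => //; apply/allP => u ur; rewrite (bd_rank_gt0 bdG) /=.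
  exact: (leq_bigmax_seq (F := fun u => rk u.2) u).
by rewrite closed_span_normE closed_span_valB closed_span_val_comb -wr.
Qed.

Section reconstruction.
Variable phi : dual X.

(** The image of phi under the adjoint of the projection onto the d_s of rank at
most q. *)
Definition head q : l1 R G :=
  \sum_(s <- fset_set (Gamma code q)) phi (basis_vector s) *: dstar s.

Lemma pairing_head q s : pairing (head q) (d s) =
  if (rk s <= q)%N then phi (basis_vector s) else 0.
Proof.
rewrite pairing_suml; under eq_bigr do rewrite pairingZl bio.
case: ifPn => sq; last first.
  rewrite big_seq big1 // => t; rewrite in_fset_set; last exact: Gamma_finite.
  rewrite inE => /GammaE tq; have [ts|_] := eqVneq t s; last by rewrite mulr0.
  by rewrite -ts tq in sq.
rewrite (bigD1_seq s) //=; last first.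
  by rewrite in_fset_set ?inE; [exact/GammaE|exact: Gamma_finite].
by rewrite eqxx mulr1 big1 ?addr0 // => t /negbTE ->; rewrite mulr0.
Qed.

Lemma pairing_head_block q p q' x : block p q' x -> (q' <= q)%N ->
  pairing (head q) (closed_span_val x) = phi x.
Proof.
move=> [r rpq ->] qq; elim: r rpq => [_|u r IH /= /andP[/andP[_ uq] /IH {}IH]].
  by rewrite big_nil pairing0r dual0.
rewrite !big_cons pairingDr pairingZr dualD dualZ IH pairing_head.
by rewrite (leq_trans uq qq).
Qed.

(** On blocks, the difference is the value of phi at the tail beyond q, which
has at most three times the norm of the block; then use density. *)
Lemma head_close q (e : R) : 0 <= e ->
  (forall q' z, block q q' z -> `|phi z| <= e * `|z|) ->
  `|phi - evaluation (head q)| <= 3 * e.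
Proof.
move=> e0 small.
have span q' x : block 0 q' x ->
    `|(phi - evaluation (head q)) x| <= 3 * e * `|x|.
  move=> xb; have [y [z [yb zb xyz]]] := block_split q xb.
  have -> : (phi - evaluation (head q)) x = phi z.
    change (phi x - pairing (head q) (closed_span_val x) = phi z).
    rewrite xyz dualD pairingDr (pairing_head_block yb) ?geq_minr //.
    rewrite [pairing _ (closed_span_val z)](_ : _ = 0) ?addr0; last first.
      rewrite -[RHS](pairing0l (closed_span_val z)).
      apply: block_pairing_eq zb => s; rewrite max0n => /andP[qs _].
      by rewrite pairing0l pairing_head leqNgt qs.
    by rewrite addrC addKr.
  rewrite max0n in zb; apply: (le_trans (small _ _ zb)).
  rewrite mulrAC mulrC ler_wpM2r //.
  apply: (tail_bound _ zb xyz); apply: block_widen yb; rewrite ?geq_minr //.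
apply: dual_norm_le => x x1; set psi := phi - _.
apply/ler_addgt0Pr => eta eta0.
pose K := dual_norm psi + 3 * e + 1.
have K0 : 0 < K.
  by rewrite ltr_wpDl // addr_ge0 ?dual_norm_ge0 // mulr_ge0.
have [q' [y [yb xy]]] := block_dense x (divr_gt0 eta0 K0).
have psix : `|psi x| <= 3 * e * `|y| + dual_norm psi * `|x - y|.
  have -> : psi x = psi y + psi (x - y) by rewrite -dualD addrC subrK.
  apply: le_trans (ler_normD _ _) _.
  by apply: lerD; [exact: span yb|exact: dual_norm_ub].
have yx : `|y| <= 1 + `|x - y|.
  rewrite -{1}(subKr x y); apply: le_trans (ler_normB _ _) _.
  by rewrite lerD2r.
have e3 : 0 <= 3 * e by rewrite mulr_ge0.
have : 3 * e * `|y| <= 3 * e * (1 + `|x - y|) by rewrite ler_wpM2l.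
have : K * `|x - y| <= eta by rewrite mulrC -ler_pdivlMr // ltW.
have : 0 <= `|x - y| by [].
rewrite /K; lra.
Qed.

End reconstruction.

(** The heads of phi form a Cauchy sequence, since their evaluations converge to
phi and evaluation is bounded below. *)
Lemma evaluation_surjective (phi : dual X) : exists f, evaluation f = phi.
Proof.
have close (e : R) : 0 < e -> exists p, forall q, (p <= q)%N ->
    `|phi - evaluation (head phi q)| <= e.
  move=> e0; have e3 : 0 < e / 3 by rewrite divr_gt0.
  have [p small] := shrinking phi e3; exists p => q pq.
  have -> : e = 3 * (e / 3) by rewrite mulrC divfK.
  apply: head_close (ltW e3) _ => q' z zb; apply: (small q').
  exact: block_widen zb.
have [|f lim_f] := @l1_complete R G (head phi).
  move=> e e0; have e4 : 0 < e / 2 / 2 by rewrite !divr_gt0.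
  have [p pe] := close _ e4; exists p => i j /pe pi /pe pj.
  apply: (le_trans (norm_le_evaluation _)).
  rewrite evaluationB.
  have -> : evaluation (head phi i) - evaluation (head phi j) =
      (phi - evaluation (head phi j)) - (phi - evaluation (head phi i)).
    by rewrite [RHS]addrC opprB addrA subrK.
  rewrite mulrC -ler_pdivlMr ?ltr0Sn // [leRHS]splitr.
  exact: le_trans (ler_normB _ _) (lerD pj pi).
exists f; apply/eqP; rewrite -subr_eq0 -normr_le0; apply/ler_addgt0Pr => e e0.
have e2 : 0 < e / 2 by rewrite divr_gt0.
have [p pe] := close _ e2; have [p' pe'] := lim_f _ e2.
have := pe (maxn p p') (leq_maxl _ _); have := pe' (maxn p p') (leq_maxr _ _).
set h := head phi _ => fh phih.
have -> : evaluation f - phi = - evaluation (h - f) - (phi - evaluation h).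
  by rewrite evaluationB !opprB addrA subrK.
rewrite add0r [leRHS]splitr; apply: le_trans (ler_normB _ _) _.
rewrite normrN; apply: lerD phih; exact: le_trans (evaluation_norm _) fh.
Qed.

Lemma evaluation_isomorphism :
  exists J : {linear l1 R G -> dual (closed_span d)},
  (forall f x, J f x = pairing f (closed_span_val x)) /\ isomorphism J.
Proof.
pose J : {linear l1 R G -> dual (closed_span d)} := HB.pack evaluation
  (GRing.isLinear.Build R (l1 R G) (dual (closed_span d)) *:%R evaluation
    evaluation_linear).
have /choice[K JK] := evaluation_surjective.
have lower f f' : `|f - f'| <= 2 * `|evaluation f - evaluation f'|.
  by rewrite -evaluationB; exact: norm_le_evaluation.
exists J; split=> //; split.
  apply: (@lipschitz_continuous _ _ _ J 1) => f f'.
  change (`|evaluation f - evaluation f'| <= 1 * `|f - f'|).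
  by rewrite -evaluationB mul1r evaluation_norm.
exists K; split.
- move=> f; apply/eqP; rewrite -subr_eq0 -normr_le0.
  change (J f) with (evaluation f).
  by rewrite (le_trans (lower _ _)) // JK subrr normr0 mulr0.
- exact: JK.
apply: (@lipschitz_continuous _ _ _ K 2) => phi psi.
by rewrite (le_trans (lower _ _)) // !JK.
Qed.

End bd_space.

Theorem proposition5p11 (R : realType) (m n N : nat -> nat)
    (G : choiceType) (code : G -> bd_tuple R G) (age : G -> nat)
    (dstar : G -> l1 R G) (P : nat -> {linear l1 R G -> l1 R G})
    (d : G -> linf R G) :
  weight_seqs m n ->
  bd_set code age ->
  net_seq code N ->
  upper_assumption code m n N age ->
  lower_assumption code m n N age ->
  bd_functionals code dstar P ->
  biorthogonal dstar d ->
  exists J : {linear l1 R G -> dual (closed_span d)},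
    (forall g x, J g x = pairing g (closed_span_val x)) /\ isomorphism J.
Proof.
move=> mn bdG _ upper _ fnl bio.
exact: evaluation_isomorphism mn bdG upper fnl bio.
Qed.
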